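(* Let $\theta\in(0,1)$, $\Theta=1/(1-\theta)$, let $f\in C_c^\infty(\mathbb R)$ be even, let $h\in C^\infty(\mathbb R)$, $h\ge0$, be supported in $[1,2]$, let $\epsilon>0$ be a fixed small parameter, and let $\rho\in C^\infty(\mathbb R)$, $\rho\ge0$, supported in $[1,2]$ with $\int\rho(x)\frac{dx}x=1$; set $d\mu(\alpha)=\Theta\rho(\alpha^\Theta)\frac{d\alpha}\alpha$. Let \[ R_{\mathrm{off}}(N)(\alpha)=\frac{2|c_1|^2\alpha^\Theta}{N^2}\sum_{N^{1-\epsilon}\ll j\ll N^{1+\epsilon}}\hat f\Big(\frac jN\Big)j^\Theta\!\!\sum_{\substack{m\ne n\\ m,n\asymp j/N^{1-\theta}}}\!\!\frac{h\big(\frac{(\theta\alpha j)^\Theta}{Nm^\Theta}\big)h\big(\frac{(\theta\alpha j)^\Theta}{Nn^\Theta}\big)}{(mn)^{\frac{\Theta+1}2}}\,e\Big(c_2(\alpha j)^\Theta\Big(\frac1{m^{\Theta-1}}-\frac1{n^{\Theta-1}}\Big)\Big), \] with $c_1=\frac{\theta^{\frac{1}{2(1-\theta)}}}{\sqrt{1-\theta}}e(-\tfrac18)$, $c_2=\theta^{\frac{\theta}{1-\theta}}-\theta^{\frac{1}{1-\theta}}$. Then for any fixed $\delta\in(0,1-\theta)$, \[ \int|R_{\mathrm{off}}(N)(\alpha)|^2\,d\mu(\alpha)\ll N^{-\delta}. \]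
   Context: $e(z)=\exp(2\pi iz)$; $\hat f(x)=\int f(y)e(-xy)dy$. The ranges $N^{1-\epsilon}\ll j\ll N^{1+\epsilon}$ and $m,n\asymp j/N^{1-\theta}$ are with fixed implied constants. *)

(* Defs.v *)
From mathcomp Require Import all_boot all_order all_algebra.
From mathcomp Require Import all_classical all_reals all_analysis.
From mathcomp Require Export complex.
Set Implicit Arguments.
Unset Strict Implicit.
Unset Printing Implicit Defensive.
Import Order.TTheory GRing.Theory Num.Theory.
Import numFieldNormedType.Exports.
Local Open Scope classical_set_scope.
Local Open Scope ring_scope.
Local Open Scope complex_scope.

Definition smooth {R : realType} (g : R -> R) : Prop :=
  forall (n : nat) (x : R), derivable (derive1n n g) x 1.

Definition csmooth {R : realType} (f : R -> R[i]) : Prop :=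
  smooth (fun x => complex.Re (f x)) /\ smooth (fun x => complex.Im (f x)).

Definition tsupp {R : realType} {V : zmodType} (g : R -> V) : set R :=
  closure [set x | g x != 0].

(* e(x) = exp(2 pi i x), at real x *)
Definition e {R : realType} (x : R) : R[i] :=
  cos (2 * pi * x) +i* sin (2 * pi * x).

(* Complex-valued Lebesgue integral over the line, componentwise. *)
Definition cintegral {R : realType} (g : R -> R[i]) : R[i] :=
  (\int[lebesgue_measure]_(y in [set: R]) complex.Re (g y))
  +i* (\int[lebesgue_measure]_(y in [set: R]) complex.Im (g y)).

Definition fourier {R : realType} (f : R -> R[i]) (x : R) : R[i] :=
  cintegral (fun y => f y * e (- (x * y))).

Definition Theta {R : realType} (theta : R) : R := (1 - theta)^-1.

Definition c1 {R : realType} (theta : R) : R[i] :=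
  (theta `^ (2 * (1 - theta))^-1 / Num.sqrt (1 - theta))%:C * e (- 8^-1).

Definition c2 {R : realType} (theta : R) : R :=
  theta `^ (theta / (1 - theta)) - theta `^ (1 - theta)^-1.

(* a1 and a2 are the implied constants of N^(1-eps) << j << N^(1+eps). *)
Definition jrange {R : realType} (eps a1 a2 N : R) : set nat :=
  [set j | a1 * N `^ (1 - eps) <= j%:R <= a2 * N `^ (1 + eps)].

(* b1 and b2 are the implied constants of m =~ j / N^(1-theta). For
   b1, N, j > 0, this forces m > 0. *)
Definition mrange {R : realType} (theta b1 b2 N : R) (j : nat) : set nat :=
  [set m | b1 * (j%:R / N `^ (1 - theta)) <= m%:R
             <= b2 * (j%:R / N `^ (1 - theta))].

(* The index sets are finite, so that the sums below are genuine finite sums. *)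
Definition Roff {R : realType} (theta eps a1 a2 b1 b2 : R)
    (f : R -> R[i]) (h : R -> R) (N alpha : R) : R[i] :=
  let T := Theta theta in
  (2 * Normc.normc (c1 theta) ^+ 2 * alpha `^ T / N ^+ 2)%:C *
  \sum_(j \in jrange eps a1 a2 N)
    (fourier f (j%:R / N) * (j%:R `^ T)%:C *
     \sum_(p \in [set p : nat * nat | [/\ p.1 != p.2,
                    mrange theta b1 b2 N j p.1 & mrange theta b1 b2 N j p.2]])
       let m : R := p.1%:R in
       let n : R := p.2%:R in
       (h ((theta * alpha * j%:R) `^ T / (N * m `^ T))
        * h ((theta * alpha * j%:R) `^ T / (N * n `^ T))
        / (m * n) `^ ((T + 1) / 2))%:C
       * e (c2 theta * (alpha * j%:R) `^ T
            * ((m `^ (T - 1))^-1 - (n `^ (T - 1))^-1))).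

(* The integral of g against d mu(alpha) = Theta rho(alpha^Theta) dalpha/alpha
   on alpha > 0, with values in the extended reals. *)
Definition int_mu {R : realType} (theta : R) (rho g : R -> R) : \bar R :=
  let T := Theta theta in
  (\int[lebesgue_measure]_(alpha in `]0%R, +oo[)
     (g alpha * (T * rho (alpha `^ T) / alpha))%:E)%E.

(* Main.v *)
(* In the variable beta = alpha^Theta the phases become linear: with s = Theta - 1
   and phi(m) = m^-s, expanding the square and integrating by parts once bounds
   the integral by a weighted sum of min(1, 1/|D|) over sextuples, where
   D = j^Theta (phi(m) - phi(n)) - j'^Theta (phi(m') - phi(n')).  After cutting
   j into dyadic blocks [J, 2J), with m, n, m', n' of size P = J / N^(1-theta),
   it suffices to show that |D| <= K has, up to logarithms, O(K P^3 J)
   solutions with m <> n when J <= N; larger J are absorbed by the decay of the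
   Fourier transform.

   For the count, group (j, j') = (g a, g b) by g = gcd(j, j'), so that
   a, b <= A = 2J/g are coprime.  For given m <> n, m', n' the ratio a/b lies in
   a short interval, and fractions a/b are A^-2 apart; this suffices when A >= P
   or K >= P.  Otherwise view (phi(m), phi(m')) as points of a grid and |D| <= K
   as saying that (m, m') and (n, n') lie on a common line of slope (a/b)^Theta.
   Such a line meets each of the P/A columns of width A, so by Cauchy-Schwarz
   at the cost of a factor P/A one may assume |m - n| <= A, as in the
   cell-counting proof of the Szemeredi-Trotter theorem for grids; the previous
   argument then applies to the few remaining quadruples. *)
Require Import Defs.
From mathcomp Require Import all_boot all_order all_algebra.
From mathcomp Require Import all_classical all_reals all_analysis.
From mathcomp Require Import zify ring lra.
Import Order.TTheory GRing.Theory Num.Theory.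
Import numFieldNormedType.Exports.
Local Open Scope classical_set_scope.
Local Open Scope ring_scope.
Local Open Scope complex_scope.
Set Implicit Arguments.
Unset Strict Implicit.
Unset Printing Implicit Defensive.

(** * Separated sets, power differences and harmonic sums *)

(** Write [A = 2J/g]. For fixed [g] the target is [K A P^3] solutions up to logarithms, because the
    sum of [A] over [g] is of order [J] up to a logarithm. The obstacle is that even a very short
    interval may contain one fraction [a/b]: over all quadruples this costs [P^4], affordable only
    when [P <= K A]. With [|m - n| <= A] a solution has [|m' - n'|] at most a multiple of [A] plus a
    multiple of [K/V], where [V = (J/P)^Theta] is at least of order [N]. So about [P^2 A^2]
    quadruples remain, and the factor [P/A] lost in Cauchy-Schwarz leads back to [P^3 A]. The count
    carries two extra factors of order [1 + J/N]. Each amplitude contains one value of the Fourier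
    transform, so decay of order two, entering squared, is what makes every block contribute at most
    [N^(theta-1)] up to logarithms. The logarithms amount to the fifth power of the number of dyadic
    blocks: two from splitting into blocks, one from the sizes of [|D|], two from harmonic sums.
    They are absorbed by the gap [1 - theta - delta]. *)

Lemma size_le_separated (R : realType) (I : eqType) (s : seq I) (F : I -> R)
    (L : R) :
  uniq s -> 0 <= L ->
  {in s &, forall i k, i != k -> 1 <= `|F i - F k|} ->
  {in s &, forall i k, `|F i - F k| <= L} ->
  (size s)%:R <= 2 * L + 1.
Proof.
case: s => [|i0 s'] us L0 sep le_L; first by rewrite /=; lra.
set s := i0 :: s' in us sep le_L *.
have i0s : i0 \in s by rewrite mem_head.
(* The shift by [L] makes the argument nonnegative. Two values at distance at least [1] cannot have
   the same integer part, and all integer parts lie between [0] and [2 * L]. *)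
pose G i := Num.trunc (F i - F i0 + L).
have G_itv i : i \in s -> (G i)%:R <= F i - F i0 + L < (G i).+1%:R.
  move=> /(le_L _ _)/(_ i0s); rewrite ler_norml => /andP[lb _].
  by apply: truncn_itv; lra.
have injG : {in s &, injective G}.
  move=> i k si sk Gik; apply/eqP; apply: contraT => /(sep _ _ si sk).
  have := G_itv i si; have := G_itv k sk; rewrite Gik -natr1.
  move=> /andP[? ?] /andP[? ?].
  by rewrite ler_normr => /orP[?|?]; lra.
have : (size (map G s) <= size (iota 0 (Num.trunc (2 * L)).+1))%N.
  apply: uniq_leq_size; first by rewrite map_inj_in_uniq.
  move=> _ /mapP[i si ->]; rewrite mem_iota /= add0n ltnS.
  rewrite truncn_ge_nat; last lra.
  have /andP[h1 _] := G_itv i si; have := le_L _ _ si i0s.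
  by rewrite ler_norml => /andP[_ h2]; lra.
rewrite size_map size_iota -(ler_nat R) -natr1 => /le_trans; apply.
by rewrite lerD2r truncn_le; lra.
Qed.

(** After division by [v^T] this is [(u / v)^T >= u / v], which holds because the ratio and the
    exponent are at least [1]. *)
Lemma powR_diff_ge (R : realType) (T u v : R) :
  1 <= T -> 0 < v -> v <= u -> v `^ (T - 1) * (u - v) <= u `^ T - v `^ T.
Proof.
move=> T1 v0 vu.
have T0 : 0 < T by lra.
have vT : v * v `^ (T - 1) = v `^ T by apply: mulr_powRB1 => //; exact: ltW.
have uT : u `^ T = v `^ T * (u / v) `^ T.
  rewrite -powRM; [|exact: ltW|by rewrite divr_ge0//; lra].
  by congr (_ `^ _); field; apply: lt0r_neq0.
have uv1 : 1 <= u / v by rewrite ler_pdivlMr// mul1r.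
have := le1r_powR uv1 T1 => h.
have -> : v `^ (T - 1) * (u - v) = v `^ T * (u / v - 1).
  by rewrite -vT; field; apply: lt0r_neq0.
rewrite uT (_ : _ - v `^ T = v `^ T * ((u / v) `^ T - 1)); last by ring.
by rewrite ler_wpM2l ?powR_ge0//; lra.
Qed.

(** Mean value theorem for [z^(-s)]; the derivative at the intermediate point is squeezed between
    its values at the endpoints. With [s = T - 1] this measures [phi m - phi n]. *)
Lemma powRN_diff (R : realType) (s x y : R) : 0 < s -> 0 < x -> x <= y ->
  s * y `^ (- (s + 1)) * (y - x) <= x `^ (- s) - y `^ (- s)
    <= s * x `^ (- (s + 1)) * (y - x).
Proof.
move=> s0 x0 xy.
have dr (c : R) : 0 < c -> is_derive c 1 (fun z : R => z `^ (- s))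
    (- s * c `^ (- (s + 1))).
  by move=> c0; have := is_derive1_powR (- s) c0; rewrite opprD.
have [c] : exists2 c : R, c \in `[x, y] & y `^ (- s) - x `^ (- s) =
    (- s * c `^ (- (s + 1))) * (y - x).
  apply: (@MVT_segment R (fun z => z `^ (- s))) => //.
    move=> z; rewrite in_itv/= => /andP[xz _]; apply: dr; lra.
  apply: derivable_within_continuous => z; rewrite in_itv/= => /andP[xz _].
  have z0 : 0 < z by lra.
  by have [] := dr z z0.
rewrite in_itv/= => /andP[xc cy] h.
have c0 : 0 < c by lra.
have -> : x `^ (- s) - y `^ (- s) = s * c `^ (- (s + 1)) * (y - x) by lra.
have mono (a b : R) : 0 < a -> a <= b -> b `^ (- (s + 1)) <= a `^ (- (s + 1)).
  move=> a0 ab; rewrite !powRN lef_pV2 ?posrE ?powR_gt0//; last lra.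
  by apply: ge0_ler_powR => //; rewrite ?nnegrE; lra.
apply/andP; split; rewrite ler_wpM2r ?ler_wpM2l ?mono//; lra.
Qed.

(** Controls the Cauchy-Schwarz loss for columns of width [A]: at most [2P/A] columns, times [3] for
    a bin and its two neighbours. *)
Lemma divn_succ_mul_le (P A : nat) : (A <= P)%N ->
  (3 * (P %/ A).+1 * A <= 6 * P)%N.
Proof.
move=> AP; have := leq_trunc_div P A; rewrite -mulnA mulSn.
by move: (P %/ A * A)%N => q; lia.
Qed.

Definition natdist (m n : nat) : nat := (m - n + (n - m))%N.

Lemma natdist_gt0 (m n : nat) : (0 < natdist m n)%N = (m != n).
Proof. by rewrite /natdist; lia. Qed.

Lemma natdistC (m n : nat) : natdist m n = natdist n m.
Proof. by rewrite /natdist addnC. Qed.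

Lemma natr_natdist (R : realType) (m n : nat) :
  (natdist m n)%:R = `|m%:R - n%:R| :> R.
Proof.
rewrite /natdist; case: (leqP m n) => [mn|/ltnW nm].
  rewrite (eqP mn) add0n natrB// distrC ger0_norm// subr_ge0 ler_nat//.
by rewrite (eqP nm) addn0 natrB// ger0_norm// subr_ge0 ler_nat.
Qed.

Definition harmonic_sum (R : realType) (n : nat) : R :=
  \sum_(q <- iota 1 n) q%:R^-1.

Lemma ler_ind (R : realType) (a b : bool) : (a -> b) -> a%:R <= b%:R :> R.
Proof. by case: a b => -[] // /(_ isT). Qed.

Lemma sum_ind (R : realType) (I : Type) (s : seq I) (a : pred I) :
  \sum_(i <- s) (a i)%:R = (size [seq i <- s | a i])%:R :> R.
Proof.
rewrite size_filter -sum1_count natr_sum [RHS]big_mkcond.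
by apply: eq_bigr => i _; case: (a i).
Qed.

(** Each distance [q >= 1] is attained by at most two points, [m + q] and [m - q]. *)
Lemma sum_natdist (R : realType) (I : seq nat) (m L : nat) (f : nat -> R) :
  uniq I -> (forall q, 0 <= f q) ->
  \sum_(n <- I) ((m != n) && (natdist m n <= L)%N)%:R * f (natdist m n)
    <= 2 * \sum_(q <- iota 1 L) f q.
Proof.
move=> uI f0.
apply: (@le_trans _ _ (\sum_(n <- I) \sum_(q <- iota 1 L)
    (natdist m n == q)%:R * f q)).
  apply: ler_sum => n _; case: (boolP (_ && _)) => [/andP[mn dL]|_]; last first.
    by rewrite mul0r sumr_ge0// => q _; rewrite mulr_ge0.
  rewrite mul1r (bigD1_seq (natdist m n)) ?iota_uniq//=; last first.
    by rewrite mem_iota natdist_gt0 mn add1n ltnS.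
  rewrite eqxx mul1r lerDl sumr_ge0// => q _; by rewrite mulr_ge0.
rewrite exchange_big mulr_sumr ler_sum// => q _.
rewrite -mulr_suml ler_wpM2r// sum_ind (_ : 2 = (size [:: m + q; m - q]%N)%:R)//.
rewrite ler_nat; apply: uniq_leq_size; first exact: filter_uniq.
move=> n; rewrite mem_filter !inE /natdist => /andP[/eqP <- _]; lia.
Qed.

Lemma harmonic_sum_ge0 (R : realType) n : 0 <= harmonic_sum R n.
Proof. by apply: sumr_ge0 => q _; rewrite invr_ge0. Qed.

Lemma harmonic_sum_ge1 (R : realType) n : (0 < n)%N -> 1 <= harmonic_sum R n.
Proof.
by case: n => // n _; rewrite /harmonic_sum /= big_cons invr1 lerDl sumr_ge0.
Qed.

Lemma le_harmonic_sum (R : realType) (m n : nat) : (m <= n)%N ->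
  harmonic_sum R m <= harmonic_sum R n.
Proof.
by move=> mn; rewrite -(subnKC mn) /harmonic_sum iotaD big_cat/= lerDl sumr_ge0.
Qed.

Lemma sum_le_size (R : realType) (X : eqType) (s : seq X) (F : X -> R) (c : R) :
  (forall x, x \in s -> F x <= c) -> \sum_(x <- s) F x <= (size s)%:R * c.
Proof.
move=> h; rewrite big_seq (le_trans (ler_sum _ h))// -big_seq.
by rewrite big_const_seq count_predT iter_addr_0 mulr_natl.
Qed.

(** Repetitions in [t] do no harm: every element of [s] is matched with one occurrence in [t], and
    the remaining terms are nonnegative. A covering list therefore suffices when pairs are regrouped
    by gcd. *)
Lemma ler_sum_subset (R : realType) (X : eqType) (s t : seq X) (G : X -> R) : uniq s ->
  {subset s <= t} -> (forall x, 0 <= G x) ->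
  \sum_(x <- s) G x <= \sum_(x <- t) G x.
Proof.
move=> us + G0; elim: s us t => [|x s IH] /=.
  by move=> _ t _; rewrite big_nil sumr_ge0.
move=> /andP[xs us] t st.
have xt : x \in t by rewrite st ?mem_head.
rewrite (perm_big _ (perm_to_rem xt)) !big_cons lerD2l IH// => y ys.
have := st y; rewrite inE ys orbT (perm_mem (perm_to_rem xt)) inE => /(_ isT).
by case: eqP ys xs => // -> ->.
Qed.

(* Expanding over the cells c, the left side is the sum over adjacent c, c' of
   n_c n_c' <= (n_c^2 + n_c'^2) / 2. *)
Lemma adjacent_pairs_le (R : realType) (C : finType) (X : Type) (s : seq X)
    (key : X -> C) (adj : rel C) (d : nat) :
  symmetric adj -> (forall c, (#|adj c| <= d)%N) ->
  \sum_(p <- s) \sum_(q <- s) (adj (key p) (key q))%:R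
    <= d%:R * \sum_(p <- s) \sum_(q <- s) (key p == key q)%:R :> R.
Proof.
move=> sym deg.
pose n c : R := \sum_(p <- s) (key p == c)%:R.
have expand (e : rel C) : \sum_(p <- s) \sum_(q <- s) (e (key p) (key q))%:R
    = \sum_c \sum_c' (e c c')%:R * (n c * n c').
  rewrite [RHS]pair_big /=.
  transitivity (\sum_(p <- s) \sum_(q <- s) \sum_(u : C * C)
      (e u.1 u.2)%:R * ((key p == u.1)%:R * (key q == u.2)%:R) : R).
    apply: eq_bigr => p _; apply: eq_bigr => q _.
    rewrite (bigD1 (key p, key q))//= !eqxx !mulr1 big1 ?addr0// => -[c c'] /=.
    rewrite xpair_eqE negb_and => /orP[] /negPf h.
      by rewrite [key p == c]eq_sym h mul0r mulr0.
    by rewrite [key q == c']eq_sym h !mulr0.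
  under [LHS]eq_bigr => p _ do rewrite exchange_big/=.
  rewrite exchange_big/=; apply: eq_bigr => u _.
  rewrite /n big_distrlr/= mulr_sumr; apply: eq_bigr => p _.
  by rewrite mulr_sumr.
rewrite !expand.
have -> : \sum_c \sum_c' (c == c')%:R * (n c * n c') = \sum_c n c ^+ 2.
  apply: eq_bigr => c _; rewrite (bigD1 c)//= eqxx mul1r big1 ?addr0//.
  by move=> c' /negPf cc; rewrite eq_sym cc mul0r.
apply: (@le_trans _ _ (\sum_c \sum_c' (adj c c')%:R * (n c ^+ 2 + n c' ^+ 2) / 2)).
  apply: ler_sum => c _; apply: ler_sum => c' _.
  rewrite -mulrA ler_wpM2l// ler_pdivlMr//.
  have := sqr_ge0 (n c - n c'); rewrite sqrrB; lra.
have -> : \sum_c \sum_c' (adj c c')%:R * (n c ^+ 2 + n c' ^+ 2) / 2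
   = \sum_c \sum_c' (adj c c')%:R * n c ^+ 2.
  transitivity (\sum_c \sum_c' ((adj c c')%:R * n c ^+ 2) / 2
    + \sum_c \sum_c' ((adj c c')%:R * n c' ^+ 2) / 2).
    rewrite -big_split; apply: eq_bigr => c _ /=; rewrite -big_split.
    by apply: eq_bigr => c' _ /=; lra.
  rewrite [X in _ + X]exchange_big/= -big_split; apply: eq_bigr => c _ /=.
  by rewrite -big_split; apply: eq_bigr => c' _ /=; rewrite (sym c'); lra.
rewrite mulr_sumr ler_sum// => c _; rewrite -mulr_suml ler_wpM2r ?sqr_ge0//.
by rewrite -natr_sum ler_nat (leq_trans _ (deg c))// -sum1_card [leqRHS]big_mkcond leq_sum.
Qed.

(** * Counting nearly equal frequencies *)

Section counting.
Context {R : realType}.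
Variables (T kappa K : R) (P J : nat) (I : seq nat).
Hypotheses (T_gt1 : 1 < T) (kappa_gt0 : 0 < kappa) (K_ge1 : 1 <= K).
Hypotheses (P_gt0 : (0 < P)%N) (J_gt0 : (0 < J)%N) (I_uniq : uniq I).
Hypothesis I_range : forall m, m \in I ->
  [/\ (0 < m)%N, (m <= P)%N & kappa * P%:R <= m%:R].

Definition phi (m : nat) : R := (m%:R `^ (T - 1))^-1.

(** The scale of the frequencies: for [j] of size [J], [j^T * (phi m - phi n)] has size
    [V * |m - n|]. For the blocks of the theorem [V] is at least a constant times [N]. *)
Let V : R := (J%:R / P%:R) `^ T.
Let H : R := harmonic_sum R P.

Let P0 : 0 < P%:R :> R. Proof. by rewrite ltr0n. Qed.
Let J0 : 0 < J%:R :> R. Proof. by rewrite ltr0n. Qed.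
Let V_gt0 : 0 < V. Proof. by rewrite powR_gt0// divr_gt0. Qed.
Let K_gt0 : 0 < K. Proof. exact: lt_le_trans K_ge1. Qed.

Let VE : V = J%:R `^ T * P%:R `^ (- T).
Proof.
by rewrite /V powRM ?invr_ge0 ?ler0n// -powR_inv1 ?ler0n// -powRrM mulN1r.
Qed.

Let size_I : (size I <= P)%N.
Proof.
rewrite -(size_iota 1 P); apply: uniq_leq_size => // m /I_range[m0 mP _].
by rewrite mem_iota m0 /= add1n ltnS.
Qed.

(** The bounds of [powRN_diff] with every point of [I] replaced by [P]; as [m >= kappa * P], the two
    sides differ only by the factor [kappa^(-T)]. *)
Lemma phi_diff_bounds (m n : nat) : m \in I -> n \in I ->
  (T - 1) * P%:R `^ (- T) * (natdist m n)%:R <= `|phi m - phi n|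
    <= (T - 1) * (kappa `^ (- T) * P%:R `^ (- T)) * (natdist m n)%:R.
Proof.
have T1 := T_gt1; have k0 := kappa_gt0; have PP := P0.
wlog mn : m n / (m <= n)%N.
  move=> hw mI nI; have [mn|/ltnW nm] := leqP m n; first exact: hw.
  by rewrite distrC (_ : natdist m n = natdist n m) ?hw// /natdist addnC.
move=> /I_range[m0 mP mk] /I_range[n0 nP nk].
have mR : 0 < m%:R :> R by rewrite ltr0n.
have mnR : m%:R <= n%:R :> R by rewrite ler_nat.
have phiE q : phi q = q%:R `^ (- (T - 1)) by rewrite powRN.
have s0 : 0 < T - 1 by lra.
have := powRN_diff s0 mR mnR; rewrite -!phiE subrK => /andP[lo hi].
rewrite natr_natdist [X in _ * X <= _]distrC [X in _ <= _ * X]distrC.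
rewrite (ger0_norm (_ : 0 <= n%:R - m%:R)) ?subr_ge0//.
have mono (a b : R) : 0 < a -> a <= b -> b `^ (- T) <= a `^ (- T).
  move=> a0 ab; rewrite !powRN lef_pV2 ?posrE ?powR_gt0//; last lra.
  by apply: ge0_ler_powR => //; rewrite ?nnegrE; lra.
have nm0 : 0 <= n%:R - m%:R :> R by lra.
have lo' : (T - 1) * P%:R `^ (- T) * (n%:R - m%:R) <= phi m - phi n.
  apply: le_trans lo; rewrite ler_wpM2r// ler_wpM2l//; first lra.
  by rewrite ?subrK mono ?ler_nat ?(lt_le_trans mR mnR).
rewrite ger0_norm ?lo'/=; last first.
  apply: le_trans lo'; rewrite mulr_ge0// mulr_ge0 ?powR_ge0//; lra.
apply: le_trans hi _; rewrite ler_wpM2r// ler_wpM2l//; first lra.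
by rewrite ?subrK -powRM ?mono ?mulr_gt0//; lra.
Qed.

(** * Pairs [(j, j')] with a given gcd and the slopes they define *)

Let slope_const : R := 2 `^ (T + 1) / (T - 1).

(** The pairs [(j / g, j' / g)] for [j, j'] in [[J, 2J)] with gcd equal to [g]. Coprimality is what
    separates the fractions. *)
Definition gcd_pairs (g : nat) : seq (nat * nat) :=
  [seq p <- [seq (a, b) | a <- iota 1 (2 * J), b <- iota 1 (2 * J)] |
    [&& coprime p.1 p.2, (J <= g * p.1 < 2 * J)%N & (J <= g * p.2 < 2 * J)%N]].

Lemma gcd_pairs_uniq g : uniq (gcd_pairs g).
Proof. by rewrite filter_uniq// allpairs_uniq ?iota_uniq// => -[? ?] -[? ?]. Qed.

Lemma mem_gcd_pairs g p : p \in gcd_pairs g ->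
  [/\ coprime p.1 p.2, (0 < p.1)%N, (0 < p.2)%N,
   (J <= g * p.1 < 2 * J)%N & (J <= g * p.2 < 2 * J)%N].
Proof.
rewrite mem_filter => /andP[/and3P[cop h1 h2] /allpairsP[[a b] [/= ai bi pE]]].
by move: ai bi h1 h2 cop; rewrite !mem_iota pE/= => /andP[? _] /andP[? _] ? ? ?.
Qed.

Lemma gcd_pairs_ratio g p : p \in gcd_pairs g ->
  1 / 2 <= (p.1%:R / p.2%:R : R) <= 2.
Proof.
move=> /mem_gcd_pairs[_ p1 p2 /andP[l1 u1] /andP[l2 u2]].
have p20 : 0 < p.2%:R :> R by rewrite ltr0n.
have half a b : (J <= g * a)%N -> (g * b < 2 * J)%N -> (b <= 2 * a)%N.
  move=> la ub; rewrite leqNgt; apply/negP => ab.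
  have : (g * (2 * a) <= g * b)%N by rewrite leq_mul2l (ltnW ab) orbT.
  by rewrite leqNgt (leq_trans ub)// mulnCA leq_mul2l la.
have ha := half _ _ l1 u2; have hb := half _ _ l2 u1.
rewrite ler_pdivlMr// ler_pdivrMr//.
move: ha hb; rewrite -!(ler_nat R) !natrM => ha hb; apply/andP; split; lra.
Qed.

Lemma gcd_pairs_le g p : p \in gcd_pairs g ->
  (p.1 <= 2 * J %/ g)%N /\ (p.2 <= 2 * J %/ g)%N.
Proof.
move=> /mem_gcd_pairs[_ p1 p2 /andP[l1 u1] /andP[l2 u2]].
have g0 : (0 < g)%N by case: g l1 u1 {l2 u2} => //; rewrite mul0n; lia.
by rewrite !leq_divRL// mulnC ltnW//= mulnC ltnW.
Qed.

Lemma coprime_cross (a b c d : nat) : (0 < b)%N -> (0 < d)%N ->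
  coprime a b -> coprime c d -> (a * d = c * b)%N -> (a, b) = (c, d).
Proof.
move=> b0 d0 ab cd E.
have bd : b = d.
  apply/eqP; rewrite eqn_dvd; apply/andP; split.
    by rewrite -(@Gauss_dvdr b a d) 1?coprime_sym// E dvdn_mull.
  by rewrite -(@Gauss_dvdr d c b) 1?coprime_sym// -E dvdn_mull.
move: E; rewrite bd => /eqP; rewrite eqn_pmul2r// => /eqP ->.
by [].
Qed.

Definition near_pair (g : nat) (p : nat * nat) (x x' : R) : bool :=
  `|(g * p.1)%:R `^ T * x - (g * p.2)%:R `^ T * x'| <= K.

(* Distinct reduced fractions with denominators at most A are A^-2 apart. *)
Lemma slope_count (g : nat) (x x' : R) : x != 0 ->
  \sum_(p <- gcd_pairs g) (near_pair g p x x')%:R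
    <= 1 + 2 `^ (T + 1) * (2 * J %/ g)%:R ^+ 2 * K / (J%:R `^ T * `|x|).
Proof.
have T1 := T_gt1; move=> x0; rewrite sum_ind.
set A := (2 * J %/ g)%N; set s := seq.filter _ _.
have xn0 : 0 < `|x| by rewrite normr_gt0.
have JT0 : 0 < J%:R `^ T :> R by rewrite powR_gt0.
(* Bound for the difference of two admissible ratios [u >= v]. Both satisfy the inequality up to
   [K / J^T], so [(u^T - v^T) * |x| <= 2K / J^T], and [powR_diff_ge] with [v >= 1/2] turns this into
   [u - v <= l]. *)
pose l : R := 2 `^ T * K / (J%:R `^ T * `|x|).
have l0 : 0 <= l by rewrite divr_ge0 ?mulr_ge0 ?powR_ge0// ltW.
have -> : 1 + 2 `^ (T + 1) * A%:R ^+ 2 * K / (J%:R `^ T * `|x|) =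
    2 * (A%:R ^+ 2 * l) + 1.
  rewrite /l powRD ?pnatr_eq0 ?implybT// powRr1//; field.
  by rewrite normr_eq0 x0 lt0r_neq0.
have memS p : p \in s -> [/\ coprime p.1 p.2, 0 < p.2%:R :> R, (p.2 <= A)%N,
    1 / 2 <= p.1%:R / p.2%:R :> R &
    `|(p.1%:R / p.2%:R) `^ T * x - x'| <= K / J%:R `^ T].
  rewrite mem_filter => /andP[near pg].
  have /andP[lo _] := gcd_pairs_ratio pg; have [_ pA] := gcd_pairs_le pg.
  have [cop p1 p2 /andP[l1 _] /andP[l2 _]] := mem_gcd_pairs pg.
  have p20 : 0 < p.2%:R :> R by rewrite ltr0n.
  split=> //.
  have g0 : (0 < g)%N by have := J_gt0; move: l1; clear; case: g => // ; rewrite mul0n; lia.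
  have gp20 : 0 < (g * p.2)%:R :> R by rewrite ltr0n muln_gt0 g0.
  have gpT : 0 < (g * p.2)%:R `^ T :> R by rewrite powR_gt0.
  (* Division by [(g * p.2)^T >= J^T] removes [g] and leaves a condition on the ratio alone. *)
  have -> : (p.1%:R / p.2%:R) `^ T * x - x' =
      ((g * p.1)%:R `^ T * x - (g * p.2)%:R `^ T * x') / (g * p.2)%:R `^ T.
    have -> : p.1%:R / p.2%:R = (g * p.1)%:R / (g * p.2)%:R :> R.
      rewrite !natrM; field; rewrite !lt0r_neq0//=; by rewrite ltr0n.
    have -> : ((g * p.1)%:R / (g * p.2)%:R) `^ T =
        (g * p.1)%:R `^ T / (g * p.2)%:R `^ T :> R.
      rewrite powRM ?invr_ge0 ?ler0n//; congr (_ * _).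
      by rewrite -powR_inv1// -powRrM mulN1r powRN.
    by field; rewrite lt0r_neq0.
  rewrite normrM normfV (gtr0_norm gpT) ler_pdivrMr// -mulrA.
  apply: le_trans near _; rewrite ler_peMr//; first exact: ltW.
  rewrite mulrC ler_pdivlMr// mul1r ge0_ler_powR ?nnegrE ?ler_nat//; lra.
apply: (@size_le_separated _ _ s (fun p => A%:R ^+ 2 * (p.1%:R / p.2%:R))).
- by rewrite filter_uniq// gcd_pairs_uniq.
- by rewrite mulr_ge0// sqr_ge0.
- move=> [a b] [c d] /memS[/= ab b0 bA _ _] /memS[/= cd d0 dA _ _] ne.
  rewrite -mulrBr normrM ger0_norm ?sqr_ge0//.
  have -> : a%:R / b%:R - c%:R / d%:R = (a%:R * d%:R - c%:R * b%:R) / (b%:R * d%:R) :> R.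
    by field; rewrite !lt0r_neq0.
  rewrite normrM normfV (@gtr0_norm _ (b%:R * d%:R)) ?mulr_gt0// mulrA.
  rewrite ler_pdivlMr ?mulr_gt0// mul1r -!natrM -natr_natdist.
  rewrite expr2 -!natrM ler_nat.
  have neq : (a * d != c * b)%N.
    by apply: contra_neq ne; apply: coprime_cross => //; rewrite -(ltr0n R).
  have d1 : (0 < natdist (a * d) (c * b))%N by rewrite natdist_gt0.
  by rewrite (leq_trans (leq_mul bA dA))// leq_pmulr.
- move=> p q /memS[_ _ _ pl pn] /memS[_ _ _ ql qn].
  rewrite -mulrBr normrM ger0_norm ?sqr_ge0// ler_wpM2l ?sqr_ge0//.
  wlog pq : p q pl pn ql qn / q.1%:R / q.2%:R <= p.1%:R / p.2%:R :> R.
    move=> hw; have [|/ltW] := leP (q.1%:R / q.2%:R : R) (p.1%:R / p.2%:R).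
      exact: hw.
    by rewrite distrC; exact: hw.
  move: pl pn ql qn pq; set u := p.1%:R / p.2%:R; set v := q.1%:R / q.2%:R => pl pn ql qn pq.
  have v0 : 0 < v by lra.
  rewrite ger0_norm ?subr_ge0//.
  have h := powR_diff_ge (ltW T_gt1) v0 pq.
  have h2 : (u `^ T - v `^ T) * `|x| <= 2 * (K / J%:R `^ T).
    apply: (@le_trans _ _ `|(u `^ T * x - x') - (v `^ T * x - x')|).
      rewrite (_ : _ - _ - _ = (u `^ T - v `^ T) * x); last by ring.
      by rewrite normrM ler_wpM2r// ler_norm.
    apply: le_trans (ler_normB _ _) _; lra.
  have h3 : (1 / 2) `^ (T - 1) <= v `^ (T - 1).
    rewrite ge0_ler_powR ?nnegrE ?divr_ge0 ?ler0n ?(ltW v0)//.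
    by rewrite subr_ge0 ltW.
  have h4 : (1 / 2) `^ (T - 1) * 2 `^ T = 2 :> R.
    rewrite div1r -powR_inv1// -powRrM -powRD; last by rewrite pnatr_eq0 implybT.
    by rewrite (_ : _ + _ = 1) ?powRr1//; ring.
  have h5 : (u - v) * `|x| * (1 / 2) `^ (T - 1) <= 2 * (K / J%:R `^ T).
    apply: le_trans h2; rewrite mulrAC ler_wpM2r//.
    apply: le_trans h; rewrite mulrC ler_wpM2r//; lra.
  have h6 : (u - v) * `|x| * 2 <= 2 * (K / J%:R `^ T) * 2 `^ T.
    by have := ler_wpM2r (powR_ge0 2 T) h5; rewrite -[X in X <= _ -> _]mulrA h4.
  rewrite /l invfM mulrA ler_pdivlMr//.
  have -> : 2 `^ T * K / J%:R `^ T = 2 `^ T * (K / J%:R `^ T) by rewrite mulrA.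
  lra.
Qed.

(** [slope_count] with [|x|] bounded below by [phi_diff_bounds], which is where the factor
    [1 / (T - 1)] of [slope_const] enters. The term [1] stands for a single fraction in an interval
    however short; summed over all quadruples it becomes the [P^4] of the direct count. *)
Lemma phi_slope (g m n : nat) (x' : R) : m \in I -> n \in I -> m != n ->
  \sum_(p <- gcd_pairs g) (near_pair g p (phi m - phi n) x')%:R
    <= 1 + slope_const * (2 * J %/ g)%:R ^+ 2 * K / V / (natdist m n)%:R.
Proof.
move=> mI nI mn; have T1 := T_gt1.
have /andP[lo _] := phi_diff_bounds mI nI.
have d0 : 0 < (natdist m n)%:R :> R by rewrite ltr0n natdist_gt0.
have s0 : 0 < T - 1 by lra.
have JT0 : 0 < J%:R `^ T :> R by rewrite powR_gt0.
have PT0 : 0 < P%:R `^ (- T) :> R by rewrite powR_gt0.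
have low0 : 0 < (T - 1) * P%:R `^ (- T) * (natdist m n)%:R.
  by rewrite !mulr_gt0.
have x0 : phi m - phi n != 0.
  by rewrite -normr_gt0; exact: lt_le_trans low0 lo.
apply: le_trans (slope_count _ x' x0) _; rewrite lerD2l.
have -> : slope_const * (2 * J %/ g)%:R ^+ 2 * K / V / (natdist m n)%:R =
    2 `^ (T + 1) * (2 * J %/ g)%:R ^+ 2 * K /
     (J%:R `^ T * ((T - 1) * P%:R `^ (- T) * (natdist m n)%:R)).
  rewrite VE /slope_const; field.
  by rewrite !lt0r_neq0.
rewrite ler_wpM2l// ?mulr_ge0 ?powR_ge0 ?sqr_ge0 ?(ltW K_gt0)//.
rewrite lef_pV2 ?posrE ?mulr_gt0//; first by rewrite ler_wpM2l// ltW.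
exact: lt_le_trans low0 lo.
Qed.

(** * Direct count for a fixed gcd *)

Lemma sumI_le (F : nat -> R) (c : R) : 0 <= c ->
  (forall x, x \in I -> F x <= c) -> \sum_(x <- I) F x <= P%:R * c.
Proof.
by move=> c0 h; apply: le_trans (sum_le_size h) _; rewrite ler_wpM2r ?ler_nat.
Qed.

Lemma exchange_big4 (X : Type) (s : seq X) (F : X -> nat -> nat -> nat -> nat -> R) :
  \sum_(p <- s) \sum_(m <- I) \sum_(n <- I) \sum_(m' <- I) \sum_(n' <- I)
    F p m n m' n' =
  \sum_(m <- I) \sum_(n <- I) \sum_(m' <- I) \sum_(n' <- I) \sum_(p <- s)
    F p m n m' n'.
Proof.
rewrite exchange_big; apply: eq_bigr => m _.
rewrite exchange_big; apply: eq_bigr => n _.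
rewrite exchange_big; apply: eq_bigr => m' _.
by rewrite exchange_big.
Qed.

Let slope_coef (g : nat) : R := slope_const * (2 * J %/ g)%:R ^+ 2 * K / V.

Let slope_coef_ge0 g : 0 <= slope_coef g.
Proof.
rewrite /slope_coef !mulr_ge0 ?invr_ge0 ?powR_ge0 ?(ltW K_gt0) ?(ltW V_gt0)//.
by rewrite subr_ge0 ltW.
Qed.

(** Common core of the direct count ([L = P], [W] always true) and the column count ([L] the column
    width, [W] bounding [|m' - n'|]). The sum over [p] is taken first, by [phi_slope]; summing
    [1 + slope_coef g / q] over the distances [q <= L] then gives [L + slope_coef g * H]. *)
Lemma sum_slopes_le (g L : nat) (w : R) (W : rel nat) : (L <= P)%N -> 0 <= w ->
  (forall m', m' \in I -> \sum_(n' <- I) (W m' n')%:R <= w) ->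
  \sum_(p <- gcd_pairs g) \sum_(m <- I) \sum_(n <- I) \sum_(m' <- I)
    \sum_(n' <- I) ((m != n) && (natdist m n <= L)%N)%:R *
      ((W m' n')%:R * (near_pair g p (phi m - phi n) (phi m' - phi n'))%:R)
  <= 2 * P%:R ^+ 2 * w * (L%:R + slope_coef g * H).
Proof.
move=> LP w0 hW; rewrite exchange_big4.
have c0 := slope_coef_ge0 g; set c := slope_coef g in c0 *.
pose f (q : nat) : R := 1 + c / q%:R.
have f0 q : 0 <= f q by rewrite addr_ge0// divr_ge0.
apply: (@le_trans _ _ (\sum_(m <- I) P%:R * w *
    (2 * \sum_(q <- iota 1 L) f q))); last first.
  have le1 : \sum_(q <- iota 1 L) f q <= L%:R + c * H.
    rewrite big_split/= lerD//.
      by apply: le_trans (sum_le_size (c := 1) _) _ => //; rewrite size_iota mulr1.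
    by rewrite -mulr_sumr ler_wpM2l// le_harmonic_sum.
  have pw : 0 <= P%:R * w by rewrite mulr_ge0.
  apply: (@le_trans _ _ (P%:R * (P%:R * w * (2 * (L%:R + c * H))))); last first.
    by rewrite le_eqVlt; apply/orP; left; apply/eqP; ring.
  apply: sumI_le => [|m _].
    by rewrite !mulr_ge0// addr_ge0// mulr_ge0// harmonic_sum_ge0.
  by rewrite ler_wpM2l// ler_wpM2l.
rewrite big_seq [leRHS]big_seq; apply: ler_sum => m mI.
apply: le_trans (ler_wpM2l _ (sum_natdist m L I_uniq f0)); last by rewrite mulr_ge0.
rewrite mulr_sumr big_seq [leRHS]big_seq; apply: ler_sum => n nI.
case: (boolP ((m != n) && _)) => [/andP[mn _]|_]; last first.
  rewrite mul0r mulr0 big1// => m' _; rewrite big1// => n' _.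
  by rewrite big1// => p _; rewrite mul0r.
rewrite mul1r -mulrA.
apply: sumI_le => [|m' m'I]; first by rewrite mulr_ge0.
apply: le_trans (ler_wpM2r (f0 _) (hW _ m'I)).
rewrite mulr_suml; apply: ler_sum => n' _.
under eq_bigr do rewrite mul1r.
by rewrite -mulr_sumr ler_wpM2l// phi_slope.
Qed.

(** Sufficient when [P <= K * (2J/g)], for then [P^4] is at most [K * (2J/g) * P^3]. *)
Lemma direct_count (g : nat) :
  \sum_(p <- gcd_pairs g) \sum_(m <- I) \sum_(n <- I) \sum_(m' <- I)
    \sum_(n' <- I) ((m != n) &&
       near_pair g p (phi m - phi n) (phi m' - phi n'))%:R
  <= 2 * P%:R ^+ 3 * (P%:R + slope_coef g * H).
Proof.
have -> : 2 * P%:R ^+ 3 * (P%:R + slope_coef g * H) =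
  2 * P%:R ^+ 2 * P%:R * (P%:R + slope_coef g * H) by rewrite exprSr !mulrA.
apply: le_trans (@sum_slopes_le g P P%:R (fun _ _ => true) _ _ _) => //; last first.
  by move=> m' _; rewrite -[leRHS]mulr1; apply: sumI_le.
apply: ler_sum => p _; rewrite big_seq [leRHS]big_seq; apply: ler_sum => m mI.
rewrite big_seq [leRHS]big_seq; apply: ler_sum => n nI.
apply: ler_sum => m' _; apply: ler_sum => n' _.
have [m0 mP _] := I_range mI; have [n0 nP _] := I_range nI.
have -> : (natdist m n <= P)%N by move: m0 mP n0 nP; rewrite /natdist; clear; lia.
by rewrite andbT mul1r; case: (m != n) => /=; rewrite ?mul0r ?mul1r.
Qed.

(** * Cauchy-Schwarz over columns *)

Let far_const : R := 2 `^ T * kappa `^ (- T).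
Let near_width : R := K / ((T - 1) * V).

Let near_width_ge0 : 0 <= near_width.
Proof.
by rewrite divr_ge0 ?mulr_ge0 ?(ltW K_gt0) ?(ltW V_gt0)// subr_ge0 ltW.
Qed.

(** The two terms of a solution differ by at most [K], and each has size [V] times its distance. In
    [far_const], [2^T] comes from [j, j'] lying in one dyadic block and [kappa^(-T)] from the two
    sides of [phi_diff_bounds]; [near_width] is the effect of the error [K]. *)
Lemma near_pair_dist (g : nat) p (m n m' n' : nat) : p \in gcd_pairs g ->
  m \in I -> n \in I -> m' \in I -> n' \in I ->
  near_pair g p (phi m - phi n) (phi m' - phi n') ->
  (natdist m' n')%:R <= far_const * (natdist m n)%:R + near_width.
Proof.
move=> pg mI nI m'I n'I near; have T1 := T_gt1.
have /andP[_ hi] := phi_diff_bounds mI nI.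
have /andP[lo _] := phi_diff_bounds m'I n'I.
have [cop p1 p2 /andP[l1 u1] /andP[l2 u2]] := mem_gcd_pairs pg.
have JT0 : 0 < J%:R `^ T :> R by rewrite powR_gt0.
have PT0 : 0 < P%:R `^ (- T) :> R by rewrite powR_gt0.
have s0 : 0 < T - 1 by lra.
have mono (a b : nat) : (a <= b)%N -> a%:R `^ T <= b%:R `^ T :> R.
  by move=> ab; rewrite ge0_ler_powR ?nnegrE ?ler_nat//; lra.
set a := (g * p.1)%N in near l1 u1; set b := (g * p.2)%N in near l2 u2.
rewrite /near_pair -/a -/b in near.
set x := phi m - phi n in hi near; set x' := phi m' - phi n' in lo near.
have h1 : J%:R `^ T * `|x'| <= (2 * J)%:R `^ T * `|x| + K.
  apply: (@le_trans _ _ (b%:R `^ T * `|x'|)); first by rewrite ler_wpM2r ?mono.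
  have -> : b%:R `^ T * `|x'| = `|b%:R `^ T * x'|.
    by rewrite normrM (ger0_norm (powR_ge0 _ _)).
  have -> : b%:R `^ T * x' =
      a%:R `^ T * x - (a%:R `^ T * x - b%:R `^ T * x') by ring.
  apply: le_trans (ler_normB _ _) _; rewrite lerD//.
  by rewrite normrM (ger0_norm (powR_ge0 _ _)) ler_wpM2r ?mono// ltnW.
have h2 : J%:R `^ T * ((T - 1) * P%:R `^ (- T) * (natdist m' n')%:R) <=
  2 `^ T * J%:R `^ T *
   ((T - 1) * (kappa `^ (- T) * P%:R `^ (- T)) * (natdist m n)%:R) + K.
  apply: le_trans (ler_wpM2l (ltW JT0) lo) _; apply: le_trans h1 _.
  by rewrite lerD2r natrM powRM// ler_wpM2l// mulr_ge0 ?powR_ge0.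
rewrite -(ler_pM2l (_ : 0 < (T - 1) * V)); last by rewrite mulr_gt0.
have -> : (T - 1) * V * (far_const * (natdist m n)%:R + near_width) =
   (T - 1) * V * far_const * (natdist m n)%:R + K.
  by rewrite /near_width; field; rewrite !lt0r_neq0.
by move: h2; rewrite VE /far_const; congr (is_true (_ <= _)); ring.
Qed.

Lemma close_count (m' : nat) (Y : R) : 0 <= Y ->
  \sum_(n' <- I) ((natdist m' n')%:R <= Y :> R)%:R <= 4 * Y + 1 :> R.
Proof.
move=> Y0; rewrite sum_ind.
have -> : 4 * Y + 1 = 2 * (2 * Y) + 1 by ring.
apply: (@size_le_separated _ _ _ (fun n : nat => n%:R)).
- exact: filter_uniq.
- by rewrite mulr_ge0.
- by move=> i k _ _ ik; rewrite -natr_natdist ler1n natdist_gt0.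
- move=> i k; rewrite !mem_filter !natr_natdist => /andP[hi _] /andP[hk _].
  apply: (@le_trans _ _ (`|m'%:R - k%:R| + `|m'%:R - i%:R|)); last by lra.
  by rewrite (_ : i%:R - k%:R = (m'%:R - k%:R) - (m'%:R - i%:R)) ?ler_normB//; ring.
Qed.

(* Cells are pairs of a bin of width K for the value of F and a column of width L
   for the first coordinate; each is adjacent to at most 3 (P / L + 1) cells. *)
Lemma column_cauchy (g L : nat) (p : nat * nat) : (0 < L)%N ->
  \sum_(m <- I) \sum_(n <- I) \sum_(m' <- I) \sum_(n' <- I)
     (near_pair g p (phi m - phi n) (phi m' - phi n'))%:R
  <= (3 * (P %/ L).+1)%:R *
     \sum_(m <- I) \sum_(n <- I) \sum_(m' <- I) \sum_(n' <- I)
       ((natdist m n <= L)%N &&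
          near_pair g p (phi m - phi n) (phi m' - phi n'))%:R :> R.
Proof.
move=> L0.
pose s := [seq (m, m') | m <- I, m' <- I].
pose F (u : nat * nat) : R :=
  (g * p.1)%:R `^ T * phi u.1 - (g * p.2)%:R `^ T * phi u.2.
have nearE (u v : nat * nat) : near_pair g p (phi u.1 - phi v.1) (phi u.2 - phi v.2)
    = (`|F u - F v| <= K).
  by rewrite /near_pair; congr (`|_| <= _); rewrite /F; ring.
(* Regrouping [(m, m')] and [(n, n')] into points [u], [v] turns the condition into
   [|F u - F v| <= K], a relation between values of one function. *)
have toS (G : nat * nat -> nat * nat -> R) :
    \sum_(m <- I) \sum_(n <- I) \sum_(m' <- I) \sum_(n' <- I) G (m, m') (n, n') =
    \sum_(u <- s) \sum_(v <- s) G u v.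
  rewrite big_allpairs; apply: eq_bigr => m _.
  rewrite exchange_big; apply: eq_bigr => m' _.
  by rewrite big_allpairs.
rewrite (toS (fun u v => (near_pair g p (phi u.1 - phi v.1) (phi u.2 - phi v.2))%:R)).
rewrite (toS (fun u v => ((natdist u.1 v.1 <= L)%N &&
  near_pair g p (phi u.1 - phi v.1) (phi u.2 - phi v.2))%:R)).
(* [S] dominates every [|F u|], so the shift by [S] makes the values nonnegative and bounds the bin
   numbers by [B]. *)
pose S : R := \sum_(u <- s) `|F u|.
have F_S u : u \in s -> 0 <= (F u + S) / K <= (2 * S) / K.
  move=> us; have : `|F u| <= S.
    rewrite /S (bigD1_seq u)//= ?lerDl ?sumr_ge0//.
    by rewrite allpairs_uniq// => -[? ?] -[? ?].
  rewrite ler_norml => /andP[h1 h2].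
  rewrite divr_ge0/= ?(ltW K_gt0) ?ler_pM2r ?invr_gt0//; lra.
pose B := Num.trunc ((2 * S) / K).
pose bin u := Num.trunc ((F u + S) / K).
have bin_itv u : u \in s -> (bin u)%:R <= (F u + S) / K < (bin u).+1%:R.
  by move=> /F_S/andP[h _]; exact: truncn_itv.
pose key u : 'I_B.+1 * 'I_(P %/ L).+1 := (inord (bin u), inord (u.1 %/ L)).
have key1 u : u \in s -> val (key u).1 = bin u.
  move=> /F_S/andP[_ h]; rewrite /= inordK// ltnS; exact: le_truncn.
have key2 u : u \in s -> val (key u).2 = (u.1 %/ L)%N.
  move=> /allpairsP[[m m'] [/= mI m'I ->]]; rewrite /= inordK// ltnS leq_div2r//.
  by have [] := I_range mI.
pose adj (c c' : 'I_B.+1 * 'I_(P %/ L).+1) := (natdist c.1 c'.1 <= 1)%N.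
have adj_sym : symmetric adj by move=> c c'; rewrite /adj natdistC.
have adj_deg c : (#|adj c| <= 3 * (P %/ L).+1)%N.
  pose near1 := [pred i : 'I_B.+1 | (natdist c.1 i <= 1)%N].
  rewrite (@eq_card _ _ [predX near1 & 'I_(P %/ L).+1]); last first.
    by move=> [i j]; rewrite !inE andbT.
  rewrite cardX card_ord leq_mul2r /= cardE -(size_map val).
  rewrite (@uniq_leq_size _ _ [:: c.1.-1; c.1 : nat; c.1.+1])//.
    by rewrite map_inj_uniq ?enum_uniq//; exact: val_inj.
  move=> _ /mapP[i + ->]; rewrite mem_enum !inE /natdist /=.
  by move: (nat_of_ord i) (nat_of_ord c.1); clear; lia.
apply: (@le_trans _ _ (\sum_(u <- s) \sum_(v <- s) (adj (key u) (key v))%:R)).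
  rewrite big_seq [leRHS]big_seq; apply: ler_sum => u us.
  rewrite big_seq [leRHS]big_seq; apply: ler_sum => v vs.
  rewrite nearE; apply: ler_ind => near.
  rewrite /adj (key1 _ us) (key1 _ vs).
  have hk : `|(F u + S) / K - (F v + S) / K| <= 1.
    rewrite -mulrBl (_ : _ - _ = F u - F v); last by ring.
    by rewrite normrM normfV (gtr0_norm K_gt0) ler_pdivrMr ?mul1r.
  have := bin_itv _ us; have := bin_itv _ vs; rewrite -!natr1.
  move=> /andP[v1 v2] /andP[u1 u2].
  rewrite -ltnS -(ltr_nat R) natr_natdist ltr_norml.
  move: hk; rewrite ler_norml => /andP[h1 h2].
  by apply/andP; split; lra.
apply: le_trans (adjacent_pairs_le R s key adj_sym adj_deg) _.
rewrite ler_wpM2l//.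
rewrite big_seq [leRHS]big_seq; apply: ler_sum => u us.
rewrite big_seq [leRHS]big_seq; apply: ler_sum => v vs.
(* Two points of one cell differ by at most [K] in [F] and by less than [L] in the first coordinate,
   so equality of cells gives back the original condition with the same [K]. *)
rewrite nearE andbC; apply: ler_ind => /eqP kuv; rewrite andbC.
have b_uv : bin u = bin v by rewrite -!key1// kuv.
have c_uv : (u.1 %/ L = v.1 %/ L)%N by rewrite -!key2// kuv.
apply/andP; split.
  have := ltn_pmod u.1 L0; have := ltn_pmod v.1 L0.
  have := divn_eq u.1 L; have := divn_eq v.1 L; rewrite c_uv /natdist.
  by move: (_ %/ _ * _)%N (_ %% _)%N (_ %% _)%N => ? ? ? -> ->; clear; lia.
have := bin_itv _ us; have := bin_itv _ vs; rewrite b_uv -natr1.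
move=> /andP[v1 v2] /andP[u1 u2].
have : `|(F u + S) / K - (F v + S) / K| <= 1.
  by rewrite ler_norml; apply/andP; split; lra.
rewrite -mulrBl (_ : _ - _ = F u - F v); last by ring.
by rewrite normrM normfV (gtr0_norm K_gt0) ler_pdivrMr ?mul1r.
Qed.

Lemma size_gcd_pairs g : (size (gcd_pairs g) <= (2 * J %/ g) ^ 2)%N.
Proof.
set A := (2 * J %/ g)%N.
have -> : (A ^ 2 = size [seq (a, b) | a <- iota 1 A, b <- iota 1 A])%N.
  by rewrite size_allpairs !size_iota.
apply: uniq_leq_size; first exact: gcd_pairs_uniq.
move=> [a b] pg; have [/= aA bA] := gcd_pairs_le pg.
have [_ /= a0 b0 _ _] := mem_gcd_pairs pg.
by apply: allpairs_f; rewrite mem_iota ?a0 ?b0 add1n ltnS.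
Qed.

(** Cauchy-Schwarz brings back the pairs with [m = n], about which [phi_slope] says nothing. There
    [near_pair_dist] confines [n'] to distance [near_width] from [m'], and the trivial bound
    [(2J/g)^2] for the number of fractions gives the first term. *)
Lemma column_count (g L : nat) : (L <= P)%N ->
  \sum_(p <- gcd_pairs g) \sum_(m <- I) \sum_(n <- I) \sum_(m' <- I)
    \sum_(n' <- I) ((natdist m n <= L)%N &&
       near_pair g p (phi m - phi n) (phi m' - phi n'))%:R
  <= (2 * J %/ g)%:R ^+ 2 * P%:R ^+ 2 * (4 * near_width + 1) +
     2 * P%:R ^+ 2 * (4 * (far_const * L%:R + near_width) + 1) *
       (L%:R + slope_coef g * H).
Proof.
move=> LP.
have fc0 : 0 <= far_const by rewrite mulr_ge0 ?powR_ge0.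
have Y0 : 0 <= far_const * L%:R + near_width by apply: addr_ge0 => //; apply: mulr_ge0.
set Y := far_const * L%:R + near_width in Y0 *.
pose W : rel nat := fun m' n' => (natdist m' n')%:R <= Y.
pose W0 : rel nat := fun m' n' => (natdist m' n')%:R <= near_width.
have := @sum_slopes_le g L (4 * Y + 1) W LP _ _.
move=> /(_ _ (fun m' _ => close_count m' Y0)) => hoff.
have {}hoff := hoff ltac:(by rewrite addr_ge0// mulr_ge0).
have w0 : 0 <= 4 * near_width + 1 by apply: addr_ge0 => //; apply: mulr_ge0.
have pw0 : 0 <= P%:R * (4 * near_width + 1) by apply: mulr_ge0.
have ppw0 : 0 <= P%:R * (P%:R * (4 * near_width + 1)) by apply: mulr_ge0.
have hdiag : \sum_(p <- gcd_pairs g) \sum_(m <- I) \sum_(n <- I)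
    \sum_(m' <- I) \sum_(n' <- I) ((m == n) && W0 m' n')%:R <=
    (2 * J %/ g)%:R ^+ 2 * P%:R ^+ 2 * (4 * near_width + 1).
  apply: (@le_trans _ _ ((size (gcd_pairs g))%:R *
      (P%:R * (P%:R * (4 * near_width + 1))))); last first.
    rewrite [leRHS](_ : _ = (2 * J %/ g)%:R ^+ 2 *
      (P%:R * (P%:R * (4 * near_width + 1)))); last by ring.
    apply: ler_wpM2r => //.
    by rewrite -natrX ler_nat size_gcd_pairs.
  apply: sum_le_size => p _; apply: sumI_le => // m mI.
  rewrite (bigD1_seq m)//= [X in _ + X]big1 ?addr0; last first.
    move=> n /negPf nm; rewrite big1// => m' _; rewrite big1// => n' _.
    by rewrite eq_sym nm.
  apply: sumI_le => // m' m'I.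
  rewrite eqxx; exact: close_count.
apply: le_trans (lerD hdiag hoff).
rewrite -big_split big_seq [leRHS]big_seq; apply: ler_sum => p pg /=.
rewrite -big_split big_seq [leRHS]big_seq; apply: ler_sum => m mI /=.
rewrite -big_split big_seq [leRHS]big_seq; apply: ler_sum => n nI /=.
rewrite -big_split big_seq [leRHS]big_seq; apply: ler_sum => m' m'I /=.
rewrite -big_split big_seq [leRHS]big_seq; apply: ler_sum => n' n'I /=.
case: (boolP ((natdist m n <= L)%N && _)) => [/andP[dL near]|_]; last first.
  by rewrite addr_ge0 ?mulr_ge0.
have hd := near_pair_dist pg mI nI m'I n'I near.
rewrite dL near andbT mulr1 -natrM -natrD ler_nat.
have [mn|mn] := eqVneq m n.
  have -> : W0 m' n'.
    by move: hd; rewrite mn /natdist subnn mulr0 add0r.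
  by [].
have -> : W m' n'; last by rewrite addnC.
by apply: le_trans hd _; rewrite lerD2r ler_wpM2l// ler_nat.
Qed.

(** The Cauchy-Schwarz factor is at most [6P/A]. Times the [4] of [4 * near_width + 1] on the
    diagonal it gives [24]; times the [2] of the other term of [column_count] it gives [12]. *)
Let cauchy_const : R := 24 + 12 * (4 * far_const + 5).

(** The column width is [A = 2J/g]. A width [L] would give about [P^3 A^2 / L] from the diagonal and
    [P^3 L] from the rest, and [L = A] balances them. *)
Lemma cauchy_count (g : nat) : (0 < 2 * J %/ g <= P)%N ->
  \sum_(p <- gcd_pairs g) \sum_(m <- I) \sum_(n <- I) \sum_(m' <- I)
    \sum_(n' <- I) ((m != n) &&
       near_pair g p (phi m - phi n) (phi m' - phi n'))%:R
  <= cauchy_const * P%:R ^+ 3 * (1 + near_width) *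
       ((2 * J %/ g)%:R + slope_coef g * H).
Proof.
move=> /andP[A0 AP].
have colc := column_count g AP.
have x0 : 0 <= slope_coef g * H.
  by apply: mulr_ge0 => //; exact: harmonic_sum_ge0.
have fc0 : 0 <= far_const by rewrite mulr_ge0 ?powR_ge0.
rewrite /cauchy_const; set A := (2 * J %/ g)%N in A0 AP colc *.
have w0 := near_width_ge0.
move: (slope_coef g * H) (near_width) (far_const) x0 w0 fc0 colc.
move=> x w f x0 w0 fc0 colc.
apply: (@le_trans _ _ ((3 * (P %/ A).+1)%:R * (A%:R ^+ 2 * P%:R ^+ 2 * (4 * w + 1) +
     2 * P%:R ^+ 2 * (4 * (f * A%:R + w) + 1) * (A%:R + x)))).
  apply: le_trans (ler_wpM2l (ler0n _ _) colc).
  rewrite mulr_sumr; apply: ler_sum => p _.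
  apply: le_trans (column_cauchy g p A0).
  apply: ler_sum => m _; apply: ler_sum => n _; apply: ler_sum => m' _.
  apply: ler_sum => n' _; apply: ler_ind => /andP[_ h]; exact: h.
have a1 : 1 <= A%:R :> R by rewrite ler1n.
have aP : A%:R <= P%:R :> R by rewrite ler_nat.
have h3 : (3 * (P %/ A).+1)%:R <= 6 * P%:R / A%:R :> R.
  rewrite ler_pdivlMr ?ltr0n// -!natrM ler_nat.
  exact: divn_succ_mul_le.
move: A%:R P%:R a1 aP h3 => a p a1 aP h3 {colc}.
have z0 : 0 <= a ^+ 2 * p ^+ 2 * (4 * w + 1) +
     2 * p ^+ 2 * (4 * (f * a + w) + 1) * (a + x).
  by repeat (apply: addr_ge0 || apply: mulr_ge0 || apply: sqr_ge0); lra.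
apply: le_trans (ler_wpM2r z0 h3) _.
have a0 : 0 < a by lra.
have -> : 6 * p / a * (a ^+ 2 * p ^+ 2 * (4 * w + 1) +
   2 * p ^+ 2 * (4 * (f * a + w) + 1) * (a + x)) =
  p ^+ 3 * (6 * a * (4 * w + 1) + 12 * ((4 * (f * a + w) + 1) / a) * (a + x)).
  by field; rewrite lt0r_neq0.
have p30 : 0 <= p ^+ 3 by rewrite exprn_ge0//; lra.
have -> : (24 + 12 * (4 * f + 5)) * p ^+ 3 * (1 + w) * (a + x) =
  p ^+ 3 * (24 * ((1 + w) * (a + x)) + 12 * ((4 * f + 5) * (1 + w)) * (a + x)).
  by ring.
rewrite ler_wpM2l// lerD//.
  have : 0 <= (1 + w) * x by rewrite mulr_ge0//; lra.
  have : 0 <= w * a by rewrite mulr_ge0//; lra.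
  by lra.
rewrite ler_wpM2r//; first lra.
rewrite ler_wpM2l// ler_pdivrMr//.
have : 0 <= f * a * w by rewrite !mulr_ge0//; lra.
have : 0 <= w * (a - 1) by rewrite mulr_ge0//; lra.
by have : 0 <= w by []; lra.
Qed.

Let gcd_const : R := cauchy_const * (1 + (T - 1)^-1) + 2.

(** Case split on [P <= K * A] with [A = 2J/g]. Otherwise [K <= P] and [A <= P]; then [near_width]
    is at most a constant times [P/V], which keeps the bound linear in [K]. *)
Lemma gcd_count (g : nat) : (0 < g <= 2 * J)%N ->
  \sum_(p <- gcd_pairs g) \sum_(m <- I) \sum_(n <- I) \sum_(m' <- I)
    \sum_(n' <- I) ((m != n) &&
       near_pair g p (phi m - phi n) (phi m' - phi n'))%:R
  <= gcd_const * P%:R ^+ 3 * (1 + P%:R / V) *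
       (K * (2 * J %/ g)%:R + slope_coef g * H).
Proof.
move=> /andP[g0 gJ]; have T1 := T_gt1; have K1 := K_ge1.
have A0 : (0 < 2 * J %/ g)%N by rewrite divn_gt0.
have a1 : 1 <= (2 * J %/ g)%:R :> R by rewrite ler1n.
have x0 : 0 <= slope_coef g * H.
  by apply: mulr_ge0 => //; exact: harmonic_sum_ge0.
have pv0 : 0 <= P%:R / V by rewrite divr_ge0// ltW.
have fc0 : 0 <= far_const by rewrite mulr_ge0 ?powR_ge0.
have cc0 : 0 <= cauchy_const by rewrite /cauchy_const; lra.
have s0 : 0 < (T - 1)^-1 by rewrite invr_gt0; lra.
have P30 : 0 <= P%:R ^+ 3 :> R by rewrite exprn_ge0.
have [big|/andP[KP AP]] : (P%:R <= K * (2 * J %/ g)%:R) \/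
    ((K <= P%:R) && (2 * J %/ g <= P)%N).
  have [PK|KP] := leP P%:R K.
    by left; apply: le_trans PK _; rewrite ler_peMr// ltW.
  have [AP|PA] := leqP (2 * J %/ g)%N P; first by right; rewrite ltW.
  left; apply: (@le_trans _ _ (2 * J %/ g)%:R).
    by rewrite ler_nat ltnW.
  by rewrite ler_peMl// (le_trans ler01).
- apply: le_trans (direct_count g) _.
  rewrite -[X in _ <= X * _ * _ * _]/(cauchy_const * (1 + (T - 1)^-1) + 2).
  move: (slope_coef g * H) (K * _) (P%:R / V) (cauchy_const) (P%:R ^+ 3) ((T - 1)^-1) x0 big pv0 cc0 P30 s0.
  move=> x y v c p3 s x0 big pv0 cc0 P30 s0.
  rewrite -[X in X <= _]mulr1 -!mulrA [X in _ <= X]mulrCA ![2 * _]mulrC.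
  rewrite -![_ * _ * 2]mulrA ler_wpM2l//.
  have : 0 <= (c * (1 + s)) * ((1 + v) * (y + x)).
    by repeat (apply: addr_ge0 || apply: mulr_ge0); try lra; apply: le_trans big.
  have y0 : 0 <= y by apply: le_trans big.
  have : 0 <= v * (y + x) by apply: mulr_ge0 => //; lra.
  move: (P%:R) big => p big; lra.
- apply: le_trans (cauchy_count _) _; first by rewrite A0.
  have wle : 1 + near_width <= (1 + (T - 1)^-1) * (1 + P%:R / V).
    have -> : near_width = (T - 1)^-1 * (K / V).
      by rewrite /near_width; field; rewrite !lt0r_neq0//; lra.
    have kv : K / V <= P%:R / V by rewrite ler_pM2r ?invr_gt0.
    have := ler_wpM2l (ltW s0) kv.
    have : 0 <= (T - 1)^-1 * (P%:R / V) by rewrite mulr_ge0// ltW.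
    lra.
  have xle : (2 * J %/ g)%:R + slope_coef g * H <=
     K * (2 * J %/ g)%:R + slope_coef g * H.
    by rewrite lerD2r ler_peMl// (le_trans ler01).
  have w1 : 0 <= 1 + near_width by apply: addr_ge0.
  have ax0 : 0 <= (2 * J %/ g)%:R + slope_coef g * H by apply: addr_ge0.
  have := ler_pM w1 ax0 wle xle.
  rewrite -[X in _ -> _ <= X * _ * _ * _]/(cauchy_const * (1 + (T - 1)^-1) + 2).
  move: (_ + slope_coef g * H) (K * _ + _) (P%:R / V) (cauchy_const) (P%:R ^+ 3)
    ((T - 1)^-1) (near_width) ax0 xle pv0 cc0 P30 s0 => y z v c p3 s w.
  move=> ax0 xle pv0 cc0 P30 s0 h.
  have := ler_wpM2l (mulr_ge0 cc0 P30) h.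
  have : 0 <= 2 * p3 * (1 + v) * z.
    by repeat (apply: mulr_ge0); lra.
  by lra.
Qed.

(** * Summation over the gcd *)

Lemma sum_gcd_weights :
  \sum_(g <- iota 1 (2 * J)) (K * (2 * J %/ g)%:R + slope_coef g * H) <=
  (2 + 4 * slope_const) * K * J%:R * (1 + J%:R / V) *
     (H * harmonic_sum R (2 * J)).
Proof.
set h := harmonic_sum R (2 * J).
have h0 : 0 <= h by exact: harmonic_sum_ge0.
have H1 : 1 <= H by exact: harmonic_sum_ge1.
have sc0 : 0 <= slope_const by rewrite divr_ge0 ?powR_ge0// subr_ge0 ltW.
have KV0 : 0 <= K / V by rewrite divr_ge0 ?(ltW K_gt0) ?(ltW V_gt0).
have jv0 : 0 <= J%:R / V by rewrite divr_ge0// ltW.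
have SA : \sum_(g <- iota 1 (2 * J)) (2 * J %/ g)%:R <= 2 * J%:R * h.
  rewrite mulr_sumr big_seq [leRHS]big_seq; apply: ler_sum => g.
  rewrite mem_iota => /andP[g0 _].
  by rewrite ler_pdivlMr ?ltr0n// -!natrM ler_nat leq_trunc_div.
have SA2 : \sum_(g <- iota 1 (2 * J)) (2 * J %/ g)%:R ^+ 2 <= 4 * J%:R ^+ 2 * h.
  rewrite mulr_sumr big_seq [leRHS]big_seq; apply: ler_sum => g.
  rewrite mem_iota => /andP[g0 _].
  rewrite ler_pdivlMr ?ltr0n// -!natrX -!natrM ler_nat.
  have := leq_trunc_div (2 * J) g; set A := (2 * J %/ g)%N => hA.
  rewrite (_ : (4 * J ^ 2 = (2 * J) ^ 2)%N); last by rewrite expnMn.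
  apply: leq_trans (_ : ((A * g) ^ 2 <= _)%N); last by rewrite leq_sqr.
  (* A factor [g] is given away: [1/g^2 <= 1/g], so that one harmonic sum serves both sums. *)
  by rewrite expnMn leq_mul2l -{1}[g]expn1 leq_pexp2l ?orbT.
rewrite big_split/= -mulr_sumr -mulr_suml.
have -> : \sum_(g <- iota 1 (2 * J)) slope_coef g =
   slope_const * (K / V) * \sum_(g <- iota 1 (2 * J)) (2 * J %/ g)%:R ^+ 2.
  by rewrite mulr_sumr; apply: eq_bigr => g _; rewrite /slope_coef; ring.
have Hh : h <= H * h by rewrite ler_peMl.
have H0 : 0 <= H by lra.
apply: (@le_trans _ _ (K * (2 * J%:R * (H * h)) +
    slope_const * (K / V) * (4 * J%:R ^+ 2 * h) * H)).
  apply: lerD.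
    apply: ler_wpM2l; first exact: ltW.
    by apply: le_trans SA _; apply: ler_wpM2l => //; rewrite mulr_ge0.
  apply: ler_wpM2r => //; apply: ler_wpM2l => //; exact: mulr_ge0.
have kjh0 : 0 <= K * J%:R * (H * h).
  by repeat apply: mulr_ge0 => //; exact: ltW.
have -> : K * (2 * J%:R * (H * h)) + slope_const * (K / V) * (4 * J%:R ^+ 2 * h) * H =
   K * J%:R * (H * h) * (2 + 4 * slope_const * (J%:R / V)) by ring.
have -> : (2 + 4 * slope_const) * K * J%:R * (1 + J%:R / V) * (H * h) =
   K * J%:R * (H * h) * ((2 + 4 * slope_const) * (1 + J%:R / V)) by ring.
apply: ler_wpM2l => //.
by move: (slope_const) (J%:R / V) sc0 jv0 => s v s0 v0; lra.
Qed.

Definition count_const : R := gcd_const * (2 + 4 * slope_const).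

Lemma count_const_ge0 : 0 <= count_const.
Proof.
have fc0 : 0 <= far_const by rewrite mulr_ge0 ?powR_ge0.
have cc0 : 0 <= cauchy_const by rewrite /cauchy_const; lra.
have s0 : 0 < (T - 1)^-1 by rewrite invr_gt0 subr_gt0.
have sc0 : 0 <= slope_const by rewrite divr_ge0 ?powR_ge0// subr_ge0 ltW.
apply: mulr_ge0; last by lra.
by apply: addr_ge0 => //; apply: mulr_ge0 => //; lra.
Qed.

(** The factor [1 + P/V] is inherited from [gcd_count], and [1 + J/V] comes from the sum of the
    squares of [2J/g]. Both are [O(1 + J/N)] in the application. *)
Lemma count_le :
  \sum_(j <- iota J J) \sum_(j' <- iota J J)
  \sum_(m <- I) \sum_(n <- I) \sum_(m' <- I) \sum_(n' <- I)
    ((m != n) && (`|j%:R `^ T * (phi m - phi n) -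
        j'%:R `^ T * (phi m' - phi n')| <= K))%:R
  <= count_const * K * P%:R ^+ 3 * J%:R * (1 + J%:R / (J%:R / P%:R) `^ T) *
      (1 + P%:R / (J%:R / P%:R) `^ T) *
      (harmonic_sum R P * harmonic_sum R (2 * J)).
Proof.
pose G (u : nat * nat) : R :=
  \sum_(m <- I) \sum_(n <- I) \sum_(m' <- I) \sum_(n' <- I)
    ((m != n) && (`|u.1%:R `^ T * (phi m - phi n) -
        u.2%:R `^ T * (phi m' - phi n')| <= K))%:R.
have G0 u : 0 <= G u by do 4 (apply: sumr_ge0 => ? _).
have -> : \sum_(j <- iota J J) \sum_(j' <- iota J J)
  \sum_(m <- I) \sum_(n <- I) \sum_(m' <- I) \sum_(n' <- I)
    ((m != n) && (`|j%:R `^ T * (phi m - phi n) -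
        j'%:R `^ T * (phi m' - phi n')| <= K))%:R =
  \sum_(u <- [seq (j, j') | j <- iota J J, j' <- iota J J]) G u.
  by rewrite big_allpairs.
pose t := [seq (g * p.1, g * p.2)%N | g <- iota 1 (2 * J), p <- gcd_pairs g].
have us : uniq [seq (j, j') | j <- iota J J, j' <- iota J J].
  by rewrite allpairs_uniq ?iota_uniq// => -[? ?] -[? ?].
apply: le_trans (ler_sum_subset (t := t) us _ G0) _.
  move=> _ /allpairsP[[j j'] [/= jJ j'J ->]].
  move: jJ j'J; rewrite !mem_iota => /andP[j1 j2] /andP[j'1 j'2].
  have j0 : (0 < j)%N by exact: leq_trans j1.
  have j'0 : (0 < j')%N by exact: leq_trans j'1.
  pose g := gcdn j j'.
  have g0 : (0 < g)%N by rewrite gcdn_gt0 j0.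
  have gj : (g * (j %/ g) = j)%N by rewrite mulnC divnK ?dvdn_gcdl.
  have gj' : (g * (j' %/ g) = j')%N by rewrite mulnC divnK ?dvdn_gcdr.
  apply/allpairsPdep; exists g, (j %/ g, j' %/ g)%N; split.
  - rewrite mem_iota g0 add1n ltnS.
    by rewrite (leq_trans (dvdn_leq j0 (dvdn_gcdl j j')))// mul2n -addnn ltnW.
  - rewrite mem_filter /= gj gj' j1 j'1 !mul2n -!addnn j2 j'2 !andbT.
    apply/andP; split.
      by rewrite /coprime -(eqn_pmul2l g0) muln_gcdr gj gj' muln1.
    apply: allpairs_f; rewrite mem_iota divn_gt0// add1n ltnS.
      rewrite (dvdn_leq j0 (dvdn_gcdl j j')).
      by rewrite (leq_trans (leq_div _ _))// ltnW.
    rewrite (dvdn_leq j'0 (dvdn_gcdr j j')).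
    by rewrite (leq_trans (leq_div _ _))// ltnW.
  - by rewrite /= gj gj'.
rewrite big_allpairs_dep/=.
apply: (@le_trans _ _ (\sum_(g <- iota 1 (2 * J)) gcd_const * P%:R ^+ 3 *
    (1 + P%:R / V) * (K * (2 * J %/ g)%:R + slope_coef g * H))).
  rewrite big_seq [leRHS]big_seq; apply: ler_sum => g.
  by rewrite mem_iota add1n ltnS; exact: gcd_count.
rewrite -mulr_sumr.
have gc0 : 0 <= gcd_const * P%:R ^+ 3 * (1 + P%:R / V).
  have fc0 : 0 <= far_const by rewrite mulr_ge0 ?powR_ge0.
  have cc0 : 0 <= cauchy_const by rewrite /cauchy_const; lra.
  have s0 : 0 < (T - 1)^-1 by rewrite invr_gt0 subr_gt0.
  repeat apply: mulr_ge0 => //.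
    by apply: addr_ge0 => //; apply: mulr_ge0 => //; lra.
  by rewrite addr_ge0// divr_ge0// ltW.
apply: le_trans (ler_wpM2l gc0 sum_gcd_weights) _.
rewrite le_eqVlt; apply/orP; left; apply/eqP.
by rewrite /count_const -/V -/H; ring.
Qed.
End counting.

(** * Integrals of continuously differentiable functions *)

(** The derivative is kept as an explicit function, so that products and dilations produce formulas
    and the continuity needed for integration by parts comes along. *)
Definition has_C1_derivative (R : realType) (g dg : R -> R) : Prop :=
  (forall x : R, is_derive x 1 g (dg x)) /\ continuous dg.

Notation rint a b F := (\int[lebesgue_measure]_(x in `[a, b]) F x).

Lemma continuous_mulR (R : realType) (F G : R -> R) :
  continuous F -> continuous G -> continuous (fun x => F x * G x).
Proof. by move=> cF cG x; apply: cvgM; [exact: cF|exact: cG]. Qed.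

Lemma continuous_addR (R : realType) (F G : R -> R) :
  continuous F -> continuous G -> continuous (fun x => F x + G x).
Proof. by move=> cF cG x; apply: cvgD; [exact: cF|exact: cG]. Qed.

Lemma continuous_sumR (R : realType) (I : Type) (s : seq I) (F : I -> R -> R) :
  (forall i, continuous (F i)) -> continuous (fun x => \sum_(i <- s) F i x).
Proof.
move=> cF; elim: s => [|i s IH].
  by under eq_fun do rewrite big_nil; move=> x; exact: cvg_cst.
by under eq_fun do rewrite big_cons; apply: continuous_addR.
Qed.

Section real_integrals.
Context {R : realType}.
Implicit Types (g dg F G : R -> R) (a b k : R).

Lemma C1_continuous g dg : has_C1_derivative g dg -> continuous g.
Proof.
move=> [hd _] x; have [d _] := hd x.
by apply: differentiable_continuous; apply/derivable1_diffP.
Qed.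

Lemma C1M f df g dg : has_C1_derivative f df -> has_C1_derivative g dg ->
  has_C1_derivative (fun x : R => f x * g x) (fun x : R => df x * g x + f x * dg x).
Proof.
move=> hf hg; have cf := C1_continuous hf; have cg := C1_continuous hg.
case: hf hg => df1 cdf [dg1 cdg]; split=> x.
  have := is_deriveM (df1 x) (dg1 x).
  rewrite (_ : f x *: dg x + g x *: df x = df x * g x + f x * dg x)//.
  by rewrite /GRing.scale/= addrC; congr (_ + _); rewrite mulrC.
apply: cvgD; apply: cvgM; [exact: cdf|exact: cg|exact: cf|exact: cdg].
Qed.

Lemma C1_scale_arg g dg k : has_C1_derivative g dg ->
  has_C1_derivative (fun x : R => g (k * x)) (fun x : R => k * dg (k * x)).
Proof.
move=> [hd cd]; split=> x.
  have h : is_derive x 1 (fun y : R => k * y) k.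
    have := is_deriveZ k (is_derive_id x 1).
    by rewrite /GRing.scale/= mulr1.
  by have := is_derive1_comp (hd (k * x)) h; rewrite mulrC.
apply: cvgM; first exact: cvg_cst.
apply: (@cvg_comp _ _ _ (fun y : R => k * y) dg _ (nbhs (k * x))); last exact: cd.
by apply: cvgM; [exact: cvg_cst|exact: cvg_id].
Qed.

Lemma C1_sin k : has_C1_derivative (fun x : R => sin (k * x))
  (fun x : R => k * cos (k * x)).
Proof.
apply: C1_scale_arg; split=> [x|]; [exact: is_derive_sin|exact: continuous_cos].
Qed.

Lemma C1_cos k : has_C1_derivative (fun x : R => cos (k * x))
  (fun x : R => k * - sin (k * x)).
Proof.
apply: (@C1_scale_arg cos (fun x => - sin x)); split=> [x|x]; first exact: is_derive_cos.
by apply: cvgN; exact: continuous_sin.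
Qed.

Lemma C1_id : has_C1_derivative (fun x : R => x) (fun=> 1).
Proof. by split=> [x|x]; [exact: is_derive_id|exact: cvg_cst]. Qed.

Lemma smooth_C1 g n : smooth g ->
  has_C1_derivative (derive1n n g) (derive1n n.+1 g).
Proof.
move=> sg; split=> x.
  by rewrite derive1nS derive1E; exact: derivableP (sg n x).
by apply: differentiable_continuous; apply/derivable1_diffP; exact: sg.
Qed.

Lemma C1_oo g dg a b : has_C1_derivative g dg -> derivable_oo_LRcontinuous g a b.
Proof.
move=> h; have c := C1_continuous h; split.
- by move=> x _; have [] := h.1 x.
- exact: cvg_at_right_filter (c a).
- exact: cvg_at_left_filter (c b).
Qed.

Lemma C1_derive1 g dg x : has_C1_derivative g dg -> derive1 g x = dg x.
Proof. by move=> h; rewrite derive1E; have [_ ->] := h.1 x. Qed.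

Lemma continuous_integrable_itv a b F : continuous F ->
  lebesgue_measure.-integrable `[a, b] (EFin \o F).
Proof.
move=> cF; apply: continuous_compact_integrable; first exact: segment_compact.
exact: continuous_subspaceT.
Qed.

Lemma rint_by_parts a b F f G g : a < b ->
  has_C1_derivative F f -> has_C1_derivative G g -> F a = 0 -> F b = 0 ->
  rint a b (fun x => F x * g x) = - rint a b (fun x => f x * G x).
Proof.
move=> ab hF hG Fa Fb.
rewrite (@Rintegration_by_parts R F G f g a b ab).
- by rewrite Fa Fb !mul0r subr0 sub0r.
- by apply: continuous_subspaceT; exact: hF.2.
- exact: C1_oo hF.
- by move=> x _; exact: C1_derive1 hF.
- by apply: continuous_subspaceT; exact: hG.2.
- exact: C1_oo hG.
- by move=> x _; exact: C1_derive1 hG.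
Qed.

Lemma rintZ a b F k : continuous F ->
  rint a b (fun x => k * F x) = k * rint a b F.
Proof.
by move=> cF; rewrite RintegralZl//; exact: continuous_integrable_itv.
Qed.

Lemma rintD a b F G : continuous F -> continuous G ->
  rint a b (fun x => F x + G x) = rint a b F + rint a b G.
Proof.
by move=> cF cG; rewrite RintegralD//; exact: continuous_integrable_itv.
Qed.

Lemma rint_sum a b (I : Type) (s : seq I) (F : I -> R -> R) :
  (forall i, continuous (F i)) ->
  rint a b (fun x => \sum_(i <- s) F i x) = \sum_(i <- s) rint a b (F i).
Proof.
move=> cF; elim: s => [|i s IH].
  rewrite big_nil; under eq_Rintegral do rewrite big_nil.
  by rewrite Rintegral_cst// mul0r.
rewrite big_cons -IH; under eq_Rintegral do rewrite big_cons.
rewrite rintD// => x.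
elim: {IH} s => [|j s IH].
  under eq_fun do rewrite big_nil; exact: cvg_cst.
under eq_fun do rewrite big_cons.
by apply: cvgD; [exact: cF|exact: IH].
Qed.

Lemma rint_le_bound a b F (B : R) : a <= b -> continuous F ->
  (forall x, x \in `[a, b] -> `|F x| <= B) -> `|rint a b F| <= B * (b - a).
Proof.
move=> ab cF hB.
have cnF : continuous (fun x => `|F x|).
  by move=> x; apply: cvg_norm; exact: cF.
apply: le_trans (le_normr_Rintegral _ (continuous_integrable_itv a b cF)) _ => //.
have -> : B * (b - a) = rint a b (fun=> B).
  rewrite Rintegral_cst// /= lebesgue_measure_itv/= lte_fin.
  have [ab'|ba] := ltP a b; first by [].
  by rewrite (_ : b - a = 0)//; lra.
apply: le_Rintegral => //.
- exact: continuous_integrable_itv cnF.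
- by apply: continuous_integrable_itv => x; exact: cvg_cst.
Qed.

Lemma rint_cos_by_parts a b g dg k : a < b -> k != 0 ->
  has_C1_derivative g dg -> g a = 0 -> g b = 0 ->
  rint a b (fun x => g x * cos (k * x)) =
    - k^-1 * rint a b (fun x => dg x * sin (k * x)).
Proof.
move=> ab k0 hg ga gb.
have cs : continuous (fun x : R => dg x * sin (k * x)).
  by move=> x; apply: cvgM; [exact: hg.2|exact: (C1_continuous (C1_sin k))].
have cc : continuous (fun x : R => g x * cos (k * x)).
  by move=> x; apply: cvgM; [exact: (C1_continuous hg)|exact: (C1_continuous (C1_cos k))].
have := rint_by_parts ab hg (C1_sin k) ga gb.
under eq_Rintegral do rewrite mulrCA.
rewrite rintZ// => h; apply: (mulfI k0).
by rewrite h mulrA mulrN divff// mulN1r.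
Qed.

Lemma rint_sin_by_parts a b g dg k : a < b -> k != 0 ->
  has_C1_derivative g dg -> g a = 0 -> g b = 0 ->
  rint a b (fun x => g x * sin (k * x)) =
    k^-1 * rint a b (fun x => dg x * cos (k * x)).
Proof.
move=> ab k0 hg ga gb.
have cs : continuous (fun x : R => dg x * cos (k * x)).
  by move=> x; apply: cvgM; [exact: hg.2|exact: (C1_continuous (C1_cos k))].
have cc : continuous (fun x : R => g x * sin (k * x)).
  by move=> x; apply: cvgM; [exact: (C1_continuous hg)|exact: (C1_continuous (C1_sin k))].
have := rint_by_parts ab hg (C1_cos k) ga gb.
under eq_Rintegral do rewrite mulrN mulrN mulrCA -mulNr.
rewrite rintZ// => h; apply: (mulfI (_ : - k != 0)); first by rewrite oppr_eq0.
by rewrite h mulNr mulrA divff// mul1r.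
Qed.

Lemma normr_cos (x : R) : `|cos x| <= 1.
Proof. by rewrite ler_norml cos_geN1 cos_le1. Qed.

Lemma normr_sin (x : R) : `|sin x| <= 1.
Proof. by rewrite ler_norml sin_geN1 sin_le1. Qed.

Lemma rint_trig_trivial a b g (B k : R) : a < b -> continuous g ->
  (forall x, x \in `[a, b] -> `|g x| <= B) ->
  `|rint a b (fun x => g x * cos (k * x))| <= B * (b - a) /\
  `|rint a b (fun x => g x * sin (k * x))| <= B * (b - a).
Proof.
move=> ab cg gB.
have bound (G : R -> R) : continuous G -> (forall x, `|G x| <= 1) ->
    `|rint a b (fun x => g x * G x)| <= B * (b - a).
  move=> cG G1; apply: rint_le_bound => [|x|x xab]; first exact: ltW.
    by apply: cvgM; [exact: cg|exact: cG].
  by rewrite normrM -[leRHS]mulr1 ler_pM// gB.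
by split; apply: bound;
  [exact: C1_continuous (C1_cos k)|move=> x; exact: normr_cos
  |exact: C1_continuous (C1_sin k)|move=> x; exact: normr_sin].
Qed.

Lemma rint_trig_decay a b g dg (B k : R) : a < b -> k != 0 ->
  has_C1_derivative g dg -> g a = 0 -> g b = 0 ->
  (forall x, x \in `[a, b] -> `|dg x| <= B) ->
  `|rint a b (fun x => g x * cos (k * x))| <= B * (b - a) / `|k| /\
  `|rint a b (fun x => g x * sin (k * x))| <= B * (b - a) / `|k|.
Proof.
move=> ab k0 hg ga gb dB.
have [hc hs] := rint_trig_trivial k ab hg.2 dB.
rewrite (rint_cos_by_parts ab k0 hg ga gb) (rint_sin_by_parts ab k0 hg ga gb).
rewrite !normrM normrN normfV mulrC [X in _ /\ X <= _]mulrC.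
by split; rewrite ler_wpM2r ?invr_ge0.
Qed.

Lemma continuous_bounded_itv a b F : a <= b -> continuous F ->
  exists2 B : R, 0 <= B & forall x, x \in `[a, b] -> `|F x| <= B.
Proof.
move=> ab cF.
have cnF : continuous (fun x => `|F x|).
  by move=> x; apply: cvg_norm; exact: cF.
have [c _ hc] := EVT_max ab (continuous_subspaceT cnF).
by exists `|F c|.
Qed.

End real_integrals.

(** * Oscillatory integrals and decay of the Fourier transform *)

Section complex_norm.
Context {R : realType}.
Implicit Types z : R[i].

Lemma normcE z : Normc.normc z ^+ 2 = complex.Re z ^+ 2 + complex.Im z ^+ 2.
Proof. by case: z => x y /=; rewrite sqr_sqrtr// addr_ge0// sqr_ge0. Qed.

Lemma normc_ge0 z : 0 <= Normc.normc z.
Proof. by case: z => x y /=; rewrite sqrtr_ge0. Qed.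

Lemma normc_le_Re_Im z : Normc.normc z <= `|complex.Re z| + `|complex.Im z|.
Proof.
rewrite -(ler_sqr (normc_ge0 z)) ?nnegrE ?addr_ge0//.
rewrite normcE sqrrD !real_normK ?num_real//.
have : 0 <= `|complex.Re z| * `|complex.Im z| by rewrite mulr_ge0.
by lra.
Qed.

Lemma Re_sum (I : Type) (s : seq I) (F : I -> R[i]) :
  complex.Re (\sum_(i <- s) F i) = \sum_(i <- s) complex.Re (F i).
Proof. by apply: (big_morph (@complex.Re R)) => [[? ?] [? ?]|]. Qed.

Lemma Im_sum (I : Type) (s : seq I) (F : I -> R[i]) :
  complex.Im (\sum_(i <- s) F i) = \sum_(i <- s) complex.Im (F i).
Proof. by apply: (big_morph (@complex.Im R)) => [[? ?] [? ?]|]. Qed.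

Lemma normc_real (x : R) : Normc.normc x%:C = `|x|.
Proof. by rewrite /= expr0n/= addr0 sqrtr_sqr. Qed.

(** Cauchy-Schwarz in the real and the imaginary part; it serves to pass from the sum over all
    dyadic blocks to single blocks. *)
Lemma normc_sum_sqr (I : Type) (s : seq I) (F : I -> R[i]) :
  Normc.normc (\sum_(i <- s) F i) ^+ 2 <=
    (size s)%:R * \sum_(i <- s) Normc.normc (F i) ^+ 2.
Proof.
have sq (G : I -> R) : (\sum_(i <- s) G i) ^+ 2 <= (size s)%:R * \sum_(i <- s) G i ^+ 2.
  elim: s => [|i s IH]; first by rewrite !big_nil expr0n/= mulr0.
  rewrite !big_cons /= -natr1; set S := \sum_(j <- s) G j in IH *.
  set Q := \sum_(j <- s) _ in IH *; set n : R := (size s)%:R in IH *.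
  have Q0 : 0 <= Q by apply: sumr_ge0 => j _; exact: sqr_ge0.
  (* The cross term of the induction step: expand [(n * G i - S)^2 >= 0] and use [S^2 <= n * Q]. For
     the empty list [S = 0]. *)
  have h : 2 * G i * S <= n * G i ^+ 2 + Q.
    have [n0|] := eqVneq (size s) 0%N.
      move: IH; rewrite /n n0 !mul0r => IH.
      have S0 : S = 0 by apply/eqP; rewrite -sqrf_eq0 eq_le IH sqr_ge0.
      by rewrite S0 mulr0 add0r.
    rewrite -lt0n => n0; have n1 : 0 < n by rewrite ltr0n.
    rewrite -(ler_pM2l n1); have := sqr_ge0 (n * G i - S).
    by rewrite sqrrB; lra.
  by rewrite sqrrD; lra.
rewrite normcE Re_sum Im_sum (le_trans (lerD (sq _) (sq _)))//.
rewrite -mulrDr -big_split/= ler_wpM2l// ler_sum// => i _.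
by rewrite normcE.
Qed.

(** The coefficients are the real part and minus the imaginary part of [c i] times the conjugate of
    [c k]. The expansion stays real, so each term integrates to a real cosine or sine integral. *)
Lemma normc_trig_sum_sqr (I : Type) (s : seq I) (c : I -> R[i])
    (w lam : I -> R) (x : R) :
  Normc.normc (\sum_(i <- s) c i * (w i)%:C * e (lam i * x)) ^+ 2 =
  \sum_(i <- s) \sum_(k <- s)
   ((complex.Re (c i) * complex.Re (c k) + complex.Im (c i) * complex.Im (c k)) *
      (w i * w k * cos (2 * pi * (lam i - lam k) * x)) +
    (complex.Re (c i) * complex.Im (c k) - complex.Im (c i) * complex.Re (c k)) *
      (w i * w k * sin (2 * pi * (lam i - lam k) * x))).
Proof.
rewrite normcE Re_sum Im_sum !expr2 !big_distrlr -big_split; apply: eq_bigr => i _.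
rewrite -big_split; apply: eq_bigr => k _ /=.
have -> : 2 * pi * (lam i - lam k) * x = 2 * pi * (lam i * x) - 2 * pi * (lam k * x).
  by ring.
rewrite cosB sinB /e; case: (c i) => ai bi; case: (c k) => ak bk /=.
by ring.
Qed.

(** Lagrange's identity: the squares of the two left sides add up to the product of the squared
    moduli. *)
Lemma normc_cross_le z1 z2 :
  `|complex.Re z1 * complex.Re z2 + complex.Im z1 * complex.Im z2|
     <= Normc.normc z1 * Normc.normc z2 /\
  `|complex.Re z1 * complex.Im z2 - complex.Im z1 * complex.Re z2|
     <= Normc.normc z1 * Normc.normc z2.
Proof.
have p0 : 0 <= Normc.normc z1 * Normc.normc z2 by rewrite mulr_ge0 ?normc_ge0.
have h1 := normcE z1; have h2 := normcE z2.
have key t : t ^+ 2 <= Normc.normc z1 ^+ 2 * Normc.normc z2 ^+ 2 ->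
    `|t| <= Normc.normc z1 * Normc.normc z2.
  move=> h; rewrite -(ler_sqr (normr_ge0 t) p0) real_normK ?num_real//.
  by rewrite exprMn.
by split; apply: key; rewrite h1 h2;
  move: (complex.Re z1) (complex.Im z1) (complex.Re z2) (complex.Im z2) => a b c d;
  [have := sqr_ge0 (a * d - b * c)|have := sqr_ge0 (a * c + b * d)]; lra.
Qed.

End complex_norm.

(* min(1, 1/|D|), with the value 1 at D = 0 *)
Definition osc_weight (R : realType) (D : R) : R :=
  if `|D| <= 1 then 1 else `|D|^-1.

Section oscillation.
Context {R : realType}.

Lemma rint_trig_osc (a b : R) (g dg : R -> R) (B D : R) : a < b ->
  has_C1_derivative g dg -> g a = 0 -> g b = 0 ->
  (forall x, x \in `[a, b] -> `|g x| <= B /\ `|dg x| <= B) ->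
  `|rint a b (fun x => g x * cos (2 * pi * D * x))| <= B * (b - a) * osc_weight D /\
  `|rint a b (fun x => g x * sin (2 * pi * D * x))| <= B * (b - a) * osc_weight D.
Proof.
move=> ab hg ga gb hB; rewrite /osc_weight.
have [D1|D1] := leP `|D| 1.
  rewrite !mulr1; apply: rint_trig_trivial => //; first exact: C1_continuous hg.
  by move=> x /hB[].
have p1 : 1 <= 2 * pi :> R by have := pi_ge2 R; lra.
have D0 : 0 < `|D| by lra.
have k0 : 2 * pi * D != 0.
  apply: mulf_neq0; last by rewrite -normr_gt0.
  by apply: lt0r_neq0; lra.
have B0 : 0 <= B * (b - a).
  rewrite mulr_ge0//; last by rewrite subr_ge0 ltW.
  have /hB[h _] : a \in `[a, b] by rewrite in_itv/= lexx ltW.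
  by apply: le_trans h.
have [hc hs] := rint_trig_decay ab k0 hg ga gb (fun x xab => (hB x xab).2).
have kD : `|2 * pi * D|^-1 <= `|D|^-1.
  rewrite lef_pV2 ?posrE ?normr_gt0//; last by rewrite -normr_gt0.
  by rewrite normrM ler_peMl// ger0_norm//; lra.
by split; [apply: le_trans hc _|apply: le_trans hs _]; exact: ler_wpM2l.
Qed.

Lemma osc_weight_ge0 (D : R) : 0 <= osc_weight D.
Proof. by rewrite /osc_weight; case: ifP => _ //; rewrite invr_ge0. Qed.

(** [r] vanishes at both endpoints, so integration by parts leaves no boundary terms. The constant
    is [6 = 2 * 3]: a cosine and a sine integral for each pair, and three summands in the derivative
    of [w i * w k * r]. *)
Lemma rint_normc_trig_sum (I : Type) (s : seq I) (c : I -> R[i])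
    (w dw : I -> R -> R) (lam : I -> R) (r dr : R -> R) (a b B : R) :
  a < b -> (forall i, has_C1_derivative (w i) (dw i)) ->
  has_C1_derivative r dr -> r a = 0 -> r b = 0 ->
  (forall i x, x \in `[a, b] -> `|w i x| <= B /\ `|dw i x| <= B) ->
  (forall x, x \in `[a, b] -> `|r x| <= B /\ `|dr x| <= B) ->
  rint a b (fun x => Normc.normc (\sum_(i <- s) c i * (w i x)%:C * e (lam i * x)) ^+ 2
     * r x) <=
  6 * B ^+ 3 * (b - a) * \sum_(i <- s) \sum_(k <- s)
    Normc.normc (c i) * Normc.normc (c k) * osc_weight (lam i - lam k).
Proof.
move=> ab hw hr ra rb wB rB.
pose A i k : R := complex.Re (c i) * complex.Re (c k) + complex.Im (c i) * complex.Im (c k).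
pose E i k : R := complex.Re (c i) * complex.Im (c k) - complex.Im (c i) * complex.Re (c k).
pose W i k := fun x => w i x * w k x * r x.
pose dW i k := fun x : R => (dw i x * w k x + w i x * dw k x) * r x +
  w i x * w k x * dr x.
have hW i k : has_C1_derivative (W i k) (dW i k).
  by have := C1M (C1M (hw i) (hw k)) hr.
pose fc i k := fun x => W i k x * cos (2 * pi * (lam i - lam k) * x).
pose fs i k := fun x => W i k x * sin (2 * pi * (lam i - lam k) * x).
have cfc i k : continuous (fc i k).
  by have := C1_continuous (C1M (hW i k) (C1_cos (2 * pi * (lam i - lam k)))).
have cfs i k : continuous (fs i k).
  by have := C1_continuous (C1M (hW i k) (C1_sin (2 * pi * (lam i - lam k)))).
have cZ (t : R) (F : R -> R) : continuous F -> continuous (fun x => t * F x).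
  by move=> cF x; apply: cvgM; [exact: cvg_cst|exact: cF].
have cfF i k : continuous (fun x : R => A i k * fc i k x + E i k * fs i k x).
  by move=> x; apply: cvgD; apply: cZ.
have csum i : continuous (fun x : R => \sum_(k <- s) (A i k * fc i k x + E i k * fs i k x)).
  move=> x; elim: (s) => [|k s' IH].
    by under eq_fun do rewrite big_nil; exact: cvg_cst.
  under eq_fun do rewrite big_cons.
  by apply: cvgD; [exact: cfF|exact: IH].
have -> : rint a b (fun x => Normc.normc (\sum_(i <- s) c i * (w i x)%:C *
    e (lam i * x)) ^+ 2 * r x) =
    \sum_(i <- s) \sum_(k <- s) (A i k * rint a b (fc i k) + E i k * rint a b (fs i k)).
  transitivity (rint a b (fun x => \sum_(i <- s) \sum_(k <- s)
      (A i k * fc i k x + E i k * fs i k x))).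
    apply: eq_Rintegral => x _.
    rewrite (normc_trig_sum_sqr s c (fun i => w i x)) mulr_suml; apply: eq_bigr => i _.
    by rewrite mulr_suml; apply: eq_bigr => k _; rewrite /fc /fs /W /A /E; ring.
  rewrite rint_sum//; apply: eq_bigr => i _.
  rewrite rint_sum//; apply: eq_bigr => k _.
  by rewrite rintD ?rintZ//; exact: cZ.
rewrite mulr_sumr; apply: ler_sum => i _; rewrite mulr_sumr; apply: ler_sum => k _.
have [hA hE] := normc_cross_le (c i) (c k).
have WB x : x \in `[a, b] -> `|W i k x| <= 3 * B ^+ 3 /\ `|dW i k x| <= 3 * B ^+ 3.
  move=> xab; have [w1 d1] := wB i x xab; have [w2 d2] := wB k x xab.
  have [r1 r2] := rB x xab.
  have M3 (u v t : R) : `|u| <= B -> `|v| <= B -> `|t| <= B -> `|u * v * t| <= B ^+ 3.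
    move=> hu hv ht; rewrite !normrM exprS expr2 mulrA.
    by rewrite !ler_pM// mulr_ge0.
  have B3 : 0 <= B ^+ 3 by apply: le_trans (M3 _ _ _ w1 w2 r1).
  split; first by apply: le_trans (M3 _ _ _ w1 w2 r1) _; lra.
  rewrite /dW mulrDl; apply: le_trans (ler_normD _ _) _.
  have h1 := ler_normD (dw i x * w k x * r x) (w i x * dw k x * r x).
  have := M3 _ _ _ d1 w2 r1; have := M3 _ _ _ w1 d2 r1; have := M3 _ _ _ w1 w2 r2.
  by lra.
have Wa : W i k a = 0 by rewrite /W ra mulr0.
have Wb : W i k b = 0 by rewrite /W rb mulr0.
have [hc hs] := rint_trig_osc (lam i - lam k) ab (hW i k) Wa Wb WB.
apply: le_trans (ler_norm _) _; apply: le_trans (ler_normD _ _) _.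
rewrite !normrM.
have := ler_pM (normr_ge0 _) (normr_ge0 _) hA hc.
have := ler_pM (normr_ge0 _) (normr_ge0 _) hE hs.
by rewrite -/(A i k) -/(E i k) -/(fc i k) -/(fs i k); lra.
Qed.

(** * Decay of the Fourier transform *)

Lemma derive1_eq0_outside (g : R -> R) (X y : R) :
  (forall x, X <= `|x| -> g x = 0) -> X < `|y| -> derive1 g y = 0.
Proof.
move=> g0 Xy; rewrite derive1E.
have E : \near y, g y = cst (0 : R) y.
  apply/nbhs_ballP; exists (`|y| - X) => /=; first by rewrite subr_gt0.
  move=> x; rewrite /ball/= => yx; apply: g0.
  by have := lerB_dist y x; lra.
by rewrite (near_eq_derive _ E) derive_cst.
Qed.

(** Two integrations by parts; the endpoints lie beyond the support, so [g] and its derivative both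
    vanish there. Decay of order [2] is what offsets the growth of the count for [J > N]. *)
Lemma rint_trig_decay2 (g : R -> R) (X Y : R) : smooth g -> 0 < X -> X < Y ->
  (forall x, X <= `|x| -> g x = 0) ->
  exists2 C : R, 0 <= C & forall x, 0 <= x ->
   `|rint (- Y) Y (fun y => g y * cos (2 * pi * x * y))| * (1 + x) ^+ 2 <= C /\
   `|rint (- Y) Y (fun y => g y * sin (2 * pi * x * y))| * (1 + x) ^+ 2 <= C.
Proof.
move=> sg X0 XY g0.
have hg := smooth_C1 0 sg; have hdg := smooth_C1 1 sg.
rewrite /= in hg hdg.
have Y0 : 0 < Y by lra.
have aY : `|Y| = Y by rewrite gtr0_norm.
have ab : - Y < Y by lra.
have gY : g Y = 0 by apply: g0; rewrite aY ltW.
have gNY : g (- Y) = 0 by apply: g0; rewrite normrN aY ltW.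
have dY : derive1n 1 g Y = 0 by apply: (derive1_eq0_outside g0); rewrite aY.
have dNY : derive1n 1 g (- Y) = 0.
  by apply: (derive1_eq0_outside g0); rewrite normrN aY.
have [B1 B10 hB1] := continuous_bounded_itv (ltW ab) (C1_continuous hg).
have [B2 B20 hB2] := continuous_bounded_itv (ltW ab) hdg.2.
pose C := 4 * (B1 + B2) * (Y - - Y).
have C0 : 0 <= C by rewrite !mulr_ge0//; lra.
exists C => // x x0.
have p1 : 1 <= 2 * pi :> R by have := pi_ge2 R; lra.
have [x1|x1] := leP x 1.
  have [hc hs] := rint_trig_trivial (2 * pi * x) ab (C1_continuous hg) hB1.
  have sq : (1 + x) ^+ 2 <= 4.
    by rewrite (_ : 4 = 2 ^+ 2) ?ler_sqr ?nnegrE; lra.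
  have E : B1 * (Y - - Y) * 4 <= C.
    rewrite /C; have : 0 <= B2 * (Y - - Y) by rewrite mulr_ge0//; lra.
    by lra.
  split; apply: le_trans E; apply: ler_pM => //; exact: sqr_ge0.
have k0 : 2 * pi * x != 0 by rewrite mulf_neq0// lt0r_neq0//; lra.
have kx : x <= `|2 * pi * x|.
  by rewrite normrM (ger0_norm x0) ler_peMl// ger0_norm; lra.
have [hc hs] := rint_trig_decay ab k0 hdg dNY dY hB2.
rewrite (rint_cos_by_parts ab k0 hg gNY gY) (rint_sin_by_parts ab k0 hg gNY gY).
set k := 2 * pi * x in k0 kx hc hs *.
have fin t : `|t| <= B2 * (Y - - Y) / `|k| -> `|k^-1| * `|t| * (1 + x) ^+ 2 <= C.
  move=> ht; have kk : 0 < `|k| by rewrite normr_gt0.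
  have sq : (1 + x) ^+ 2 <= 4 * `|k| ^+ 2.
    rewrite (_ : 4 * `|k| ^+ 2 = (2 * `|k|) ^+ 2); last by ring.
    by rewrite ler_sqr ?nnegrE; lra.
  have -> : C = `|k^-1| * (4 * (B1 + B2) * (Y - - Y) / `|k|) * `|k| ^+ 2.
    by rewrite normfV /C; field; rewrite lt0r_neq0.
  have Bk : 0 <= B2 * (Y - - Y) / `|k| by rewrite divr_ge0// mulr_ge0//; lra.
  have Bk1 : 0 <= B1 * (Y - - Y) / `|k| by rewrite divr_ge0// mulr_ge0//; lra.
  apply: (@le_trans _ _ (`|k^-1| * (B2 * (Y - - Y) / `|k|) * (4 * `|k| ^+ 2))).
    apply: ler_pM => //; first by rewrite mulr_ge0.
    - exact: sqr_ge0.
    - by rewrite ler_wpM2l.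
  rewrite -[leLHS]mulrA -[leRHS]mulrA ler_wpM2l//.
  have k2 : 0 <= `|k| ^+ 2 by rewrite sqr_ge0.
  have := mulr_ge0 Bk1 k2; move: (`|k|^-1) (`|k| ^+ 2) => p q; lra.
by split; rewrite !normrM ?normrN; apply: fin.
Qed.

Lemma rint_setT (F : R -> R) (Y : R) :
  (forall y, Y < `|y| -> F y = 0) ->
  \int[lebesgue_measure]_(y in [set: R]) F y = rint (- Y) Y F.
Proof.
move=> F0; rewrite [RHS]Rintegral_mkcond; apply: eq_Rintegral => y _.
rewrite patchE; case: ifPn => //; rewrite notin_setE /= in_itv/= -ler_norml => /negP.
by rewrite -ltNge => /F0.
Qed.

Lemma fourier_decay (f : R -> R[i]) : csmooth f -> compact (tsupp f) ->
  exists2 C : R, 0 <= C &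
    forall x, 0 <= x -> Normc.normc (fourier f x) * (1 + x) ^+ 2 <= C.
Proof.
move=> [su sv] /compact_bounded[M [_ hM]].
pose X : R := `|M| + 1.
have X0 : 0 < X by rewrite ltr_wpDl.
have MX : M < X by rewrite (le_lt_trans (ler_norm M))// ltrDl.
have f0 y : X < `|y| -> f y = 0.
  move=> Xy; apply/eqP; apply: contraT => fy.
  have : tsupp f y by apply: subset_closure.
  by move=> /(hM X MX) /=; rewrite leNgt Xy.
(* [f] vanishes for [|y| > X]. One unit more makes this hold from [|y| >= X1] on, another puts [-Y]
   and [Y] strictly outside. *)
pose X1 := X + 1; pose Y := X + 2.
have ab : - Y < Y by rewrite /Y; lra.
have u0 y : X1 <= `|y| -> complex.Re (f y) = 0 by move=> h; rewrite f0//; rewrite /X1 in h; lra.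
have v0 y : X1 <= `|y| -> complex.Im (f y) = 0 by move=> h; rewrite f0//; rewrite /X1 in h; lra.
have X10 : 0 < X1 by rewrite /X1; lra.
have XY : X1 < Y by rewrite /X1 /Y; lra.
have [Cu Cu0 hu] := rint_trig_decay2 su X10 XY u0.
have [Cv Cv0 hv] := rint_trig_decay2 sv X10 XY v0.
exists (2 * (Cu + Cv)) => [|x x0]; first by rewrite mulr_ge0// addr_ge0.
have cu : continuous (fun y => complex.Re (f y)) by exact: C1_continuous (smooth_C1 0 su).
have cv : continuous (fun y => complex.Im (f y)) by exact: C1_continuous (smooth_C1 0 sv).
have cc := C1_continuous (C1_cos (2 * pi * x)).
have cs := C1_continuous (C1_sin (2 * pi * x)).
have cM (F G : R -> R) : continuous F -> continuous G -> continuous (fun y => F y * G y).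
  by move=> cF cG y; apply: cvgM; [exact: cF|exact: cG].
have fY y : Y < `|y| -> f y = 0 by move=> h; apply: f0; rewrite /Y in h; lra.
have trig y : 2 * pi * - (x * y) = - (2 * pi * x * y) by ring.
have ReE : complex.Re (fourier f x) =
    rint (- Y) Y (fun y => complex.Re (f y) * cos (2 * pi * x * y)) +
    rint (- Y) Y (fun y => complex.Im (f y) * sin (2 * pi * x * y)).
  rewrite -rintD; [|exact: cM|exact: cM].
  rewrite /fourier /cintegral /= (@rint_setT _ Y); last first.
    by move=> y /fY ->; rewrite mul0r.
  apply: eq_Rintegral => y _; rewrite /e trig cosN sinN.
  by case: (f y) => p q /=; ring.
have ImE : complex.Im (fourier f x) =
    rint (- Y) Y (fun y => complex.Im (f y) * cos (2 * pi * x * y)) +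
    -1 * rint (- Y) Y (fun y => complex.Re (f y) * sin (2 * pi * x * y)).
  rewrite -rintZ; last exact: cM.
  rewrite -rintD; [|exact: cM|by move=> y; apply: cvgM; [exact: cvg_cst|exact: cM]].
  rewrite /fourier /cintegral /= (@rint_setT _ Y); last first.
    by move=> y /fY ->; rewrite mul0r.
  apply: eq_Rintegral => y _; rewrite /e trig cosN sinN.
  by case: (f y) => p q /=; ring.
have [h1 h2] := hu x x0; have [h3 h4] := hv x x0.
have sq : 0 <= (1 + x) ^+ 2 by exact: sqr_ge0.
apply: le_trans (ler_wpM2r sq (normc_le_Re_Im _)) _.
rewrite ReE ImE mulN1r.
pose I1 := rint (- Y) Y (fun y => complex.Re (f y) * cos (2 * pi * x * y)).
pose I2 := rint (- Y) Y (fun y => complex.Re (f y) * sin (2 * pi * x * y)).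
pose I3 := rint (- Y) Y (fun y => complex.Im (f y) * cos (2 * pi * x * y)).
pose I4 := rint (- Y) Y (fun y => complex.Im (f y) * sin (2 * pi * x * y)).
rewrite -/I1 -/I2 -/I3 -/I4.
have : (`|I1 + I4| + `|I3 - I2|) * (1 + x) ^+ 2 <=
    (`|I1| + `|I4| + (`|I3| + `|I2|)) * (1 + x) ^+ 2.
  by rewrite ler_wpM2r// lerD ?ler_normD ?ler_normB.
move: (h1 : `|I1| * (1 + x) ^+ 2 <= Cu) (h2 : `|I2| * (1 + x) ^+ 2 <= Cu).
move: (h3 : `|I3| * (1 + x) ^+ 2 <= Cv) (h4 : `|I4| * (1 + x) ^+ 2 <= Cv).
move: I1 I2 I3 I4 ((1 + x) ^+ 2) => I1 I2 I3 I4 q; clear.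
by rewrite !(mulrDl _ _ q); lra.
Qed.

End oscillation.

(** * The substitution beta = alpha^Theta *)

Lemma powR_derive1_near (R : realType) (T x : R) : 0 < x ->
  derive1 (fun z : R => z `^ T) z @[z --> x] --> T * x `^ (T - 1).
Proof.
move=> x0.
have c1 : T * z `^ (T - 1) @[z --> x] --> T * x `^ (T - 1).
  apply: cvgM; first exact: cvg_cst.
  have [d _] := is_derive1_powR (T - 1) x0.
  have c : {for x, continuous (fun z : R => z `^ (T - 1))}.
    by apply: differentiable_continuous; apply/derivable1_diffP.
  exact: c.
apply: cvg_trans c1; apply: near_eq_cvg.
apply/nbhs_ballP; exists x => //= z; rewrite /ball/= => xz.
have z0 : 0 < z by have := ler_norm (x - z); lra.
by rewrite powR_derive1// in_itv/= z0.
Qed.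

(** The hypothesis on [G] already contains the Jacobian of [beta = alpha^Theta]. The interval
    [[1/2, 3]] is wider than [[1, 2]], so that a weight containing [rho] vanishes at its endpoints,
    as integration by parts will require. *)
Lemma int_mu_substitution (R : realType) (theta : R) (rho g G : R -> R) :
  0 < theta < 1 -> (forall x, ~~ (1 <= x <= 2) -> rho x = 0) -> continuous G ->
  (forall alpha, 0 < alpha ->
    g alpha * (Theta theta * rho (alpha `^ Theta theta) / alpha) =
    G (alpha `^ Theta theta) * (Theta theta * alpha `^ (Theta theta - 1))) ->
  int_mu theta rho g = (rint (1 / 2) 3 G)%:E.
Proof.
move=> /andP[th0 th1] rho0 cG gG; rewrite /int_mu.
have half1 : 1 / 2 <= 1 :> R by lra.
have half3 : 1 / 2 <= 3 :> R by lra.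
have two3 : 2 <= 3 :> R by lra.
have T0 : 0 < Theta theta by rewrite invr_gt0 subr_gt0.
move: (Theta theta) T0 gG => T T0 gG.
pose a : R := (1 / 2) `^ T^-1; pose b : R := 3 `^ T^-1.
have a0 : 0 < a by rewrite powR_gt0//; lra.
have FaE : a `^ T = 1 / 2 by rewrite -powRrM mulVf ?lt0r_neq0// powRr1//; lra.
have FbE : b `^ T = 3 by rewrite -powRrM mulVf ?lt0r_neq0// powRr1//; lra.
have incr (x y : R) : 0 <= x -> x < y -> x `^ T < y `^ T.
  move=> x0 xy; apply: gt0_ltr_powR => //; rewrite nnegrE//.
  exact: le_trans x0 (ltW xy).
have b0 : 0 < b by rewrite powR_gt0//; lra.
have ab : a <= b.
  rewrite leNgt; apply/negP => ba.
  by move/(incr _ _ (ltW b0)) : ba; rewrite FaE FbE ltNge half3.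
transitivity (\int[lebesgue_measure]_(x in `[a, b])
    (((G \o (fun z : R => z `^ T)) * derive1 (fun z : R => z `^ T)) x)%:E)%E.
  rewrite [LHS]integral_mkcond [RHS]integral_mkcond.
  apply: eq_integral => x _; rewrite !patchE.
  case: ifPn => [|]; rewrite ?notin_setE ?inE /= in_itv/= ?andbT => x0; last first.
    case: ifPn => //; rewrite inE/= in_itv/= => /andP[ax _].
    by case: x0; apply: lt_le_trans ax.
  rewrite gG//; case: ifPn => [|]; rewrite ?notin_setE ?inE/= in_itv/=.
    move=> _; congr (_%:E); rewrite -[RHS]/(G (x `^ T) * derive1 (fun z : R => z `^ T) x).
    by rewrite powR_derive1// in_itv/= x0.
  (* Outside [[a, b]] the factor [rho] vanishes; since [T * x^(T-1)] is not zero, [gG] forces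
     [G (x^T) = 0]. *)
  move=> xab; have -> : G (x `^ T) = 0.
    have rho1 : rho (x `^ T) = 0.
      apply: rho0; apply/negP => /andP[h1 h2]; apply: xab.
      apply/andP; split; rewrite leNgt; apply/negP => h.
        by move/(incr _ _ (ltW x0)) : h; rewrite FaE ltNge (le_trans half1 h1).
      by move/(incr _ _ (ltW b0)) : h; rewrite FbE ltNge (le_trans h2 two3).
    have := gG x x0; rewrite rho1 mulr0 mul0r mulr0 => /esym/eqP.
    rewrite mulf_eq0 => /orP[/eqP//|].
    by rewrite mulf_eq0 (gt_eqF T0)/= (gt_eqF (powR_gt0 _ x0)).
  by rewrite mul0r.
have der (x : R) : 0 < x -> is_derive x 1 (fun z : R => z `^ T) (T * x `^ (T - 1)).
  exact: is_derive1_powR.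
have cF (x : R) : 0 < x -> {for x, continuous (fun z : R => z `^ T)}.
  move=> /der[d _]; apply: differentiable_continuous; exact/derivable1_diffP.
rewrite -(@integration_by_substitution_increasing R (fun z : R => z `^ T) G a b ab).
- rewrite FaE FbE /Rintegral fineK//.
  apply: integrable_fin_num => //; exact: continuous_integrable_itv.
- move=> x y; rewrite !in_itv/= => /andP[ax _] _; by apply: incr; exact: le_trans (ltW a0) ax.
- move=> x; rewrite in_itv/= => /andP[ax _].
  have x0 : 0 < x by exact: lt_trans a0 ax.
  rewrite /continuous_at powR_derive1 ?in_itv/= ?x0//.
  exact: powR_derive1_near.
- by apply/cvg_ex; exists (T * a `^ (T - 1)); apply: cvg_at_right_filter; exact: powR_derive1_near.
- by apply/cvg_ex; exists (T * b `^ (T - 1)); apply: cvg_at_left_filter; exact: powR_derive1_near.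
- split.
  + by move=> x; rewrite in_itv/= => /andP[ax _]; have [] := der x (lt_trans a0 ax).
  + by apply: cvg_at_right_filter; exact: cF.
  + by apply: cvg_at_left_filter; exact: cF.
- exact: continuous_subspaceT.
Qed.

(** * Summation of oscillatory weights *)

Lemma osc_weight_le1 (R : realType) (D : R) : osc_weight D <= 1.
Proof.
rewrite /osc_weight; case: ifPn => //; rewrite -ltNge => D1.
by rewrite invf_le1 ?ltW// (lt_trans ltr01).
Qed.

(** Lets [c2 theta] be taken out of the frequencies at the cost of a constant factor. *)
Lemma osc_weight_scale (R : realType) (c D : R) : 0 < c ->
  osc_weight (c * D) <= (1 + c^-1) * osc_weight D.
Proof.
move=> c0; have ci0 : 0 < c^-1 by rewrite invr_gt0.
have [D1|D1] := leP `|D| 1.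
  apply: le_trans (osc_weight_le1 _) _.
  by rewrite /osc_weight D1 mulr1 lerDl ltW.
have D0 : 0 < `|D| by exact: lt_trans D1.
have -> : osc_weight D = `|D|^-1 by rewrite /osc_weight leNgt D1.
apply: (@le_trans _ _ (c^-1 * `|D|^-1)); last first.
  by rewrite ler_wpM2r ?lerDr// invr_ge0.
rewrite /osc_weight normrM (gtr0_norm c0) -invfM mulrC; case: ifPn => // cD.
by rewrite -[leLHS]invr1 lef_pV2 ?posrE ?mulr_gt0.
Qed.

Lemma osc_weight_layers (R : realType) (L : nat) (D : R) : `|D| <= 2 ^+ L ->
  osc_weight D <= 2 * \sum_(i <- iota 0 L.+1) 2 ^- i * (`|D| <= 2 ^+ i)%R%:R.
Proof.
move=> DL; have ex : exists i, `|D| <= 2 ^+ i by exists L.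
have t0 (i : nat) : 0 <= 2 ^- i * (`|D| <= 2 ^+ i)%R%:R :> R.
  by rewrite mulr_ge0// invr_ge0 exprn_ge0.
(* [k] is the least exponent with [|D| <= 2^k]. If [k > 0] then [|D| > 2^(k-1)], so the weight is at
   most [2 * 2^-k] and the term [i = k] alone suffices. *)
case: (ex_minnP ex) => k hk mink.
have kL : (k <= L)%N by exact: mink.
rewrite (bigD1_seq k) ?iota_uniq ?mem_iota ?ltnS//= hk mulr1.
have : 0 <= \sum_(i <- iota 0 L.+1 | i != k) 2 ^- i * (`|D| <= 2 ^+ i)%R%:R :> R.
  exact: sumr_ge0.
suff : osc_weight D <= 2 * 2 ^- k by lra.
case: k hk mink {kL} => [|k] hk mink.
  by apply: le_trans (osc_weight_le1 _) _; rewrite expr0 invr1; lra.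
have Dk : 2 ^+ k < `|D|.
  by rewrite ltNge; apply/negP => /mink; rewrite ltnn.
have pk : 0 < 2 ^+ k :> R by rewrite exprn_gt0.
rewrite exprS invfM mulrA divff// mul1r.
rewrite /osc_weight; case: ifPn => [D1|_]; last by rewrite lef_pV2 ?posrE// ?ltW// (lt_trans pk).
have : 1 <= 2 ^+ k :> R by rewrite exprn_ege1// ler1n.
by move=> ?; lra.
Qed.

(** Each dyadic block [2^k < q <= 2^(k+1)] contributes at most [1]. *)
Lemma harmonic_sum_pow2 (R : realType) (k : nat) :
  harmonic_sum R (2 ^ k) <= k.+1%:R.
Proof.
elim: k => [|k IH]; first by rewrite expn0 /harmonic_sum /= big_seq1 invr1.
rewrite expnS mul2n -addnn /harmonic_sum iotaD big_cat /= -(natr1 k.+1).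
rewrite lerD//; have p0 : 0 < (2 ^ k)%:R :> R by rewrite ltr0n expn_gt0.
apply: (@le_trans _ _ (\sum_(q <- iota (1 + 2 ^ k) (2 ^ k)) (2 ^ k)%:R^-1)).
  rewrite big_seq [leRHS]big_seq; apply: ler_sum => q.
  rewrite mem_iota => /andP[kq _]; rewrite lef_pV2 ?posrE//.
    by rewrite ler_nat (leq_trans _ kq)// leq_addl.
  by rewrite ltr0n (leq_trans _ kq).
by rewrite big_const_seq count_predT size_iota iter_addr_0 -[_^-1 *+ _]mulr_natl divff ?lt0r_neq0.
Qed.

(* Layer cake over the dyadic sizes of the frequency. *)
Lemma osc_sum_le (R : realType) (T kappa : R) (P J L : nat) (I : seq nat) :
  1 < T -> 0 < kappa -> (0 < P)%N -> (0 < J)%N -> uniq I ->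
  (forall m, m \in I -> [/\ (0 < m)%N, (m <= P)%N & kappa * P%:R <= m%:R]) ->
  2 * (2 * J)%:R `^ T <= 2 ^+ L ->
  \sum_(j <- iota J J) \sum_(j' <- iota J J)
  \sum_(m <- I) \sum_(n <- I) \sum_(m' <- I) \sum_(n' <- I)
    (m != n)%:R * osc_weight (j%:R `^ T * (phi T m - phi T n) -
        j'%:R `^ T * (phi T m' - phi T n'))
  <= 2 * L.+1%:R * (count_const T kappa * P%:R ^+ 3 * J%:R *
      (1 + J%:R / (J%:R / P%:R) `^ T) * (1 + P%:R / (J%:R / P%:R) `^ T) *
      (harmonic_sum R P * harmonic_sum R (2 * J))).
Proof.
move=> T1 k0 P0 J0 uI rI hL.
set X := count_const T kappa * _ * _ * _ * _ * _.
pose D j j' m n m' n' : R := j%:R `^ T * (phi T m - phi T n) -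
        j'%:R `^ T * (phi T m' - phi T n').
have phi01 (m : nat) : m \in I -> 0 <= phi T m <= 1.
  move=> /rI[m0 _ _]; have m1 : 1 <= m%:R :> R by rewrite ler1n.
  rewrite /phi invr_ge0 powR_ge0/= invf_le1 ?powR_gt0 ?ltr0n//.
  by rewrite -{1}(powRr0 m%:R) ler_powR// subr_ge0 ltW.
(* As [phi] takes values in [[0, 1]], every [|D|] is at most [2 * (2J)^T <= 2^L], so finitely many
   layers exhaust the weight. *)
have Dle j j' m n m' n' : j \in iota J J -> j' \in iota J J -> m \in I -> n \in I ->
    m' \in I -> n' \in I -> `|D j j' m n m' n'| <= 2 ^+ L.
  move=> jJ j'J mI nI m'I n'I; apply: le_trans hL.
  have one (i p q : nat) : i \in iota J J -> p \in I -> q \in I ->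
      `|i%:R `^ T * (phi T p - phi T q)| <= (2 * J)%:R `^ T.
    rewrite mem_iota => /andP[_ iJ] pI qI.
    rewrite normrM (ger0_norm (powR_ge0 _ _)) -[leRHS]mulr1 ler_pM ?powR_ge0//.
      apply: ge0_ler_powR; rewrite ?nnegrE//; first by lra.
      by rewrite ler_nat mul2n -addnn ltnW.
    have := phi01 _ pI; have := phi01 _ qI => /andP[a1 a2] /andP[a3 a4].
    by rewrite ler_norml; apply/andP; split; lra.
  apply: le_trans (ler_normB _ _) _.
  by have := one _ _ _ jJ mI nI; have := one _ _ _ j'J m'I n'I; lra.
apply: (@le_trans _ _ (\sum_(i <- iota 0 L.+1) 2 * 2 ^- i *
  (\sum_(j <- iota J J) \sum_(j' <- iota J J)
  \sum_(m <- I) \sum_(n <- I) \sum_(m' <- I) \sum_(n' <- I)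
    ((m != n) && (`|D j j' m n m' n'| <= 2 ^+ i))%:R))); last first.
  have bnd (i : nat) : i \in iota 0 L.+1 -> 2 * 2 ^- i *
    (\sum_(j <- iota J J) \sum_(j' <- iota J J)
    \sum_(m <- I) \sum_(n <- I) \sum_(m' <- I) \sum_(n' <- I)
    ((m != n) && (`|D j j' m n m' n'| <= 2 ^+ i))%:R) <= 2 * X.
    move=> _; have i0 : 0 < 2 ^+ i :> R by rewrite exprn_gt0.
    have i1 : 1 <= 2 ^+ i :> R by rewrite exprn_ege1// ler1n.
    (* With [K = 2^i] the factor [K] of the count cancels the weight [2^-i]: each of the [L + 1]
       layers contributes the same bound. *)
    have := @count_le R T kappa (2 ^+ i) P J I T1 k0 i1 P0 J0 uI rI.
    move=> /(ler_wpM2l (_ : 0 <= 2 * 2 ^- i)) h.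
    apply: le_trans (h _) _; first by rewrite mulr_ge0// invr_ge0 ltW.
    rewrite le_eqVlt; apply/orP; left; apply/eqP; rewrite /X; field.
    by rewrite !lt0r_neq0// powR_gt0// divr_gt0 ?ltr0n.
  apply: le_trans (sum_le_size bnd) _.
  by rewrite size_iota mulrA [_ * 2]mulrC.
have push (i : nat) (F : nat -> nat -> nat -> nat -> nat -> nat -> R) (t : R) :
  t * (\sum_(j <- iota J J) \sum_(j' <- iota J J)
    \sum_(m <- I) \sum_(n <- I) \sum_(m' <- I) \sum_(n' <- I) F j j' m n m' n') =
  \sum_(j <- iota J J) \sum_(j' <- iota J J)
    \sum_(m <- I) \sum_(n <- I) \sum_(m' <- I) \sum_(n' <- I) (t * F j j' m n m' n').
  do 6 (rewrite mulr_sumr; apply: eq_bigr => ? _).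
  by [].
under [leRHS]eq_bigr => i _ do rewrite (push i).
rewrite [leRHS]exchange_big big_seq [leRHS]big_seq; apply: ler_sum => j jJ /=.
rewrite [leRHS]exchange_big big_seq [leRHS]big_seq; apply: ler_sum => j' j'J /=.
rewrite [leRHS]exchange_big big_seq [leRHS]big_seq; apply: ler_sum => m mI /=.
rewrite [leRHS]exchange_big big_seq [leRHS]big_seq; apply: ler_sum => n nI /=.
rewrite [leRHS]exchange_big big_seq [leRHS]big_seq; apply: ler_sum => m' m'I /=.
rewrite [leRHS]exchange_big big_seq [leRHS]big_seq; apply: ler_sum => n' n'I /=.
rewrite -/(D j j' m n m' n'); case: (m != n) => /=; last first.
  by rewrite mul0r big1// => i _; rewrite mulr0.
rewrite mul1r; apply: le_trans (osc_weight_layers (Dle _ _ _ _ _ _ jJ j'J mI nI m'I n'I)) _.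
by rewrite mulr_sumr; apply: ler_sum => i _; rewrite mulrA.
Qed.

(** This is [1 + x <= exp x] at [x = n * eta * ln 2]. It turns powers of the number of dyadic blocks
    into small powers of [N]. *)
Lemma succ_le_powR2 (R : realType) (eta : R) : 0 < eta ->
  exists2 C : R, 0 < C & forall n : nat, n.+1%:R <= C * (2 ^+ n) `^ eta.
Proof.
move=> e0; have l2 : 0 < ln 2 :> R by rewrite ln_gt0// ltr1n.
have el : 0 < eta * ln 2 by rewrite mulr_gt0.
exists (1 + (eta * ln 2)^-1) => [|n]; first by rewrite addr_gt0// invr_gt0.
have -> : (2 ^+ n) `^ eta = expR (n%:R * (eta * ln 2)) :> R.
  rewrite /powR expf_eq0 pnatr_eq0 andbF lnXn// -mulr_natl.
  by congr expR; ring.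
have h := expR_ge1Dx (n%:R * (eta * ln 2)).
have n0 : 0 <= n%:R :> R by [].
apply: (@le_trans _ _ ((1 + (eta * ln 2)^-1) * (1 + n%:R * (eta * ln 2)))); last first.
  by rewrite ler_wpM2l// addr_ge0// invr_ge0 ltW.
have -> : (1 + (eta * ln 2)^-1) * (1 + n%:R * (eta * ln 2)) =
   1 + n%:R + n%:R * (eta * ln 2) + (eta * ln 2)^-1.
  by field; rewrite !lt0r_neq0.
have : 0 <= n%:R * (eta * ln 2) by rewrite mulr_ge0// ltW.
have : 0 < (eta * ln 2)^-1 by rewrite invr_gt0.
by rewrite -natr1; lra.
Qed.

(** * Dyadic blocks *)

(** Moves the condition into the summand, so that within a block one list can serve for all [j]. *)
Lemma fsbig_filter (V : nmodType) (X : choiceType) (A : set X) (a : pred X)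
    (s : seq X) (F : X -> V) : uniq s -> (forall i, A i <-> i \in s /\ a i) ->
  \sum_(i \in A) F i = \sum_(i <- s) (if a i then F i else 0).
Proof.
move=> us hA; have -> : A = [set` [seq i <- s | a i]].
  apply/seteqP; split=> i /=; rewrite mem_filter.
    by move=> /hA[-> ->].
  by move=> /andP[ai si]; apply/hA.
by rewrite -fsbig_seq ?filter_uniq// big_filter big_mkcond.
Qed.

Lemma sum_dyadic (V : nmodType) (F : nat -> V) (B : nat) :
  \sum_(j <- iota 1 (2 ^ B).-1) F j =
  \sum_(b <- iota 0 B) \sum_(j <- iota (2 ^ b) (2 ^ b)) F j.
Proof.
elim: B => [|B IH]; first by rewrite !big_nil.
have p0 : (0 < 2 ^ B)%N by rewrite expn_gt0.
have -> : ((2 ^ B.+1).-1 = (2 ^ B).-1 + 2 ^ B)%N.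
  by rewrite expnS; move: (2 ^ B)%N p0 => x; lia.
by rewrite -[B.+1]addn1 !iotaD !big_cat/= big_seq1 IH add1n prednK.
Qed.

Lemma leq_addn_mulS (k B : nat) : ((B + k).+1 <= k.+1 * B.+1)%N.
Proof. by rewrite mulSn addSn ltnS leq_add2l leq_pmulr. Qed.

Lemma leq_mulS_mulS (B L : nat) : ((1 + B * L).+1 <= L.+2 * B.+1)%N.
Proof. by nia. Qed.

Lemma Theta_gt1 (R : realType) (theta : R) : 0 < theta < 1 -> 1 < Theta theta.
Proof.
move=> /andP[th0 th1].
have ht : 0 < 1 - theta by lra.
rewrite /Theta -[ltLHS]invr1 ltf_pV2 ?posrE//; lra.
Qed.

Lemma powR_div (R : realType) (t x y : R) : 0 <= x -> 0 < y ->
  (x / y) `^ t = x `^ t / y `^ t.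
Proof.
move=> x0 y0; rewrite powRM// ?invr_ge0 ?(ltW y0)//; congr (_ * _).
by rewrite -powR_inv1 ?(ltW y0)// -powRrM mulN1r powRN.
Qed.

(** The two exponents differ by [1], so [c2 theta] factors as
    [theta^(theta/(1-theta)) * (1 - theta)]. Positivity is what [osc_weight_scale] asks for. *)
Lemma c2_gt0 (R : realType) (theta : R) : 0 < theta < 1 -> 0 < c2 theta.
Proof.
move=> /andP[th0 th1].
have ht : 1 - theta != 0 by apply: lt0r_neq0; lra.
have -> : c2 theta = theta `^ (theta / (1 - theta)) * (1 - theta).
  have E : (1 - theta)^-1 = theta / (1 - theta) + 1 by field.
  rewrite /c2 {2}E powRD; last by rewrite (lt0r_neq0 th0) implybT.
  by rewrite powRr1 ?(ltW th0)// mulrBr mulr1.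
by rewrite mulr_gt0 ?powR_gt0//; lra.
Qed.

Section blocks.
Context {R : realType}.
Variables (theta eps a1 a2 b1 b2 : R) (f : R -> R[i]) (N : R).

Definition in_jrange (j : nat) : bool :=
  a1 * N `^ (1 - eps) <= j%:R <= a2 * N `^ (1 + eps).

Definition in_mrange (j m : nat) : bool :=
  b1 * (j%:R / N `^ (1 - theta)) <= m%:R <= b2 * (j%:R / N `^ (1 - theta)).

(* Amplitude and dilation vanish outside the ranges of Roff, so that for all j in
   [2^b, 2^(b+1)) the sums over m and n may run over the common block_range. *)
Definition amplitude (t : nat * (nat * nat)) : R[i] :=
  let: (j, (m, n)) := t in
  if [&& in_jrange j, m != n, in_mrange j m & in_mrange j n] then
    (2 * Normc.normc (c1 theta) ^+ 2 / N ^+ 2)%:C * fourier f (j%:R / N) *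
      (j%:R `^ Theta theta / (m%:R * n%:R) `^ ((Theta theta + 1) / 2))%:C
  else 0.

Definition dilation (j m : nat) : R :=
  if in_mrange j m then
    (theta * j%:R) `^ Theta theta / (N * m%:R `^ Theta theta) else 0.

Definition cutoff (h : R -> R) (t : nat * (nat * nat)) (x : R) : R :=
  let: (j, (m, n)) := t in h (dilation j m * x) * h (dilation j n * x).

Definition frequency (t : nat * (nat * nat)) : R :=
  let: (j, (m, n)) := t in
  c2 theta * (j%:R `^ Theta theta *
    (phi (Theta theta) m - phi (Theta theta) n)).

(** Since [j < 2^(b+1)], no [m] in range exceeds this. It is the [P] of the counting lemmas, with
    [kappa = b1 / (2 * b2)] in [block_range]. *)
Definition block_bound (b : nat) : nat :=
  Num.trunc (2 * b2 * ((2 ^ b)%:R / N `^ (1 - theta))).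

Definition block_range (b : nat) : seq nat :=
  [seq m <- iota 1 (block_bound b) |
     b1 / (2 * b2) * (block_bound b)%:R <= m%:R].

Definition block (b : nat) : seq (nat * (nat * nat)) :=
  [seq (j, u) | j <- iota (2 ^ b) (2 ^ b),
     u <- [seq (m, n) | m <- block_range b, n <- block_range b]].

Hypotheses (theta01 : 0 < theta < 1) (N_ge1 : 1 <= N).
Hypotheses (a1_gt0 : 0 < a1) (b1_gt0 : 0 < b1) (b2_gt0 : 0 < b2).

Lemma mem_block_range (b j m : nat) : (2 ^ b <= j < 2 * 2 ^ b)%N ->
  in_mrange j m -> m \in block_range b.
Proof.
move=> /andP[bj jb] /andP[lo hi].
have b10 := b1_gt0; have b20 := b2_gt0.
have N0 : 0 < N by exact: lt_le_trans N_ge1.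
have D0 : 0 < (N `^ (1 - theta))^-1 by rewrite invr_gt0 powR_gt0.
set D := (N `^ (1 - theta))^-1 in lo hi D0.
have bjR : (2 ^ b)%:R <= j%:R :> R by rewrite ler_nat.
have jbR : j%:R <= 2 * (2 ^ b)%:R :> R by rewrite -natrM ler_nat ltnW.
have J0 : 0 < (2 ^ b)%:R :> R by rewrite ltr0n expn_gt0.
have M0 : 0 <= 2 * b2 * ((2 ^ b)%:R * D) by rewrite !mulr_ge0// ltW.
rewrite mem_filter mem_iota /block_bound -/D.
have /andP[t1 _] := truncn_itv M0.
apply/and3P; split.
- apply: (@le_trans _ _ (b1 / (2 * b2) * (2 * b2 * ((2 ^ b)%:R * D)))).
    by rewrite ler_wpM2l// divr_ge0// ltW// mulr_gt0.
  apply: le_trans lo.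
  have -> : b1 / (2 * b2) * (2 * b2 * ((2 ^ b)%:R * D)) = b1 * ((2 ^ b)%:R * D).
    by field; rewrite lt0r_neq0.
  by rewrite ler_wpM2l ?(ltW b10)// ler_wpM2r// ltW.
- rewrite -(ltr0n R); apply: lt_le_trans lo.
  by rewrite !mulr_gt0// (lt_le_trans J0).
- rewrite add1n ltnS truncn_ge_nat//; apply: le_trans hi _.
  have := ler_wpM2r (ltW D0) jbR.
  by move=> /(ler_wpM2l (ltW b20)); congr (is_true (_ <= _)); ring.
Qed.

(** In the variable [beta = alpha^Theta] this is a trigonometric sum with smooth cutoffs, the form
    that [rint_normc_trig_sum] treats. Any [B] with [2^B] beyond the range of [j] will do. *)
Lemma Roff_blocks (h : R -> R) (B : nat) (alpha : R) : 0 < alpha ->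
  a2 * N `^ (1 + eps) < (2 ^ B)%:R ->
  Roff theta eps a1 a2 b1 b2 f h N alpha = (alpha `^ Theta theta)%:C *
    \sum_(b <- iota 0 B) \sum_(t <- block b)
      amplitude t * (cutoff h t (alpha `^ Theta theta))%:C *
        e (frequency t * alpha `^ Theta theta).
Proof.
move=> al0 aB; rewrite /Roff; set beta := alpha `^ Theta theta.
set q1 := Normc.normc (c1 theta).
have N0 : 0 < N by exact: lt_le_trans N_ge1.
have a1N : 0 < a1 * N `^ (1 - eps) by rewrite mulr_gt0// powR_gt0.
have b10 := b1_gt0; have b20 := b2_gt0.
have /andP[th0 th1] := theta01.
rewrite (@fsbig_filter _ _ _ in_jrange (iota 1 (2 ^ B).-1)); last first.
  move=> j; split=> [jr|[]//]; split=> //; rewrite mem_iota.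
  have /andP[j1 j2] := jr.
  have j0 : (0 < j)%N by rewrite -(ltr0n R); exact: lt_le_trans j1.
  have := le_lt_trans j2 aB; rewrite ltr_nat j0 => jB.
  by rewrite add1n prednK// expn_gt0.
  exact: iota_uniq.
rewrite sum_dyadic !mulr_sumr; apply: eq_bigr => b _.
rewrite big_allpairs !mulr_sumr; rewrite big_seq [RHS]big_seq.
apply: eq_bigr => j; rewrite mem_iota addnn -mul2n => jb.
have j0 : (0 < j)%N.
  by have /andP[bj _] := jb; apply: leq_trans bj; rewrite expn_gt0.
rewrite big_allpairs; case: ifPn => [jr|jr]; last first.
  rewrite mulr0 big1 ?mulr0// => m _; rewrite big1// => n _.
  by rewrite /amplitude (negPf jr) !mul0r.
rewrite (@fsbig_filter _ _ _
  (fun p : nat * nat => [&& p.1 != p.2, in_mrange j p.1 & in_mrange j p.2])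
  [seq (m, n) | m <- block_range b, n <- block_range b]); last first.
  move=> [m n]; split=> /= [[mn mr nr]|[_ /and3P[mn mr nr]]//].
  split; last by apply/and3P; split.
  by apply: allpairs_f; [exact: mem_block_range jb mr|exact: mem_block_range jb nr].
  by rewrite allpairs_uniq ?filter_uniq ?iota_uniq// => -[? ?] -[? ?].
rewrite big_allpairs !mulr_sumr; apply: eq_bigr => m _.
rewrite !mulr_sumr; apply: eq_bigr => n _.
rewrite /amplitude -/q1 /cutoff /frequency /=.
rewrite jr /=; case: ifPn => [/and3P[mn mr nr]|_]; last by rewrite !mul0r !mulr0.
have argE (q : nat) : in_mrange j q ->
    (theta * alpha * j%:R) `^ Theta theta / (N * q%:R `^ Theta theta) =
    dilation j q * beta.
  move=> qr; rewrite /dilation qr.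
  have -> : theta * alpha * j%:R = alpha * (theta * j%:R) by ring.
  rewrite powRM ?(ltW al0)// ?mulr_ge0 ?(ltW th0)// -/beta.
  by ring.
rewrite !argE// (@powRM R alpha j%:R) ?(ltW al0)// -/beta.
have -> : c2 theta * (beta * j%:R `^ Theta theta) *
    ((m%:R `^ (Theta theta - 1))^-1 - (n%:R `^ (Theta theta - 1))^-1) =
  c2 theta * (j%:R `^ Theta theta *
    (phi (Theta theta) m - phi (Theta theta) n)) * beta.
  by rewrite /phi; ring.
move: (e _) (fourier _ _) => [e1 e2] [f1 f2].
by simpc; apply/eqP; rewrite eq_complex /=; apply/andP; split; apply/eqP; ring.
Qed.

Let N_gt0 : 0 < N. Proof. exact: lt_le_trans N_ge1. Qed.

Let scale_gt0 : 0 < N `^ (1 - theta). Proof. exact: powR_gt0. Qed.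

Lemma scale_powR_Theta : (N `^ (1 - theta)) `^ Theta theta = N.
Proof.
have /andP[th0 th1] := theta01.
by rewrite -powRrM /Theta mulfV ?powRr1 ?(ltW N_gt0)//; apply: lt0r_neq0; lra.
Qed.

Lemma in_mrange_ge (b j m : nat) : (2 ^ b <= j)%N -> in_mrange j m ->
  b1 * ((2 ^ b)%:R / N `^ (1 - theta)) <= m%:R.
Proof.
move=> bj /andP[lo _]; apply: le_trans lo.
by rewrite ler_wpM2l ?(ltW b1_gt0)// ler_wpM2r ?invr_ge0 ?(ltW scale_gt0)// ler_nat.
Qed.

(** The bound [m >= b1 * j / N^(1-theta)] and [(1 - theta) * Theta = 1] give
    [N * m^Theta >= (b1 * j)^Theta]. The result is uniform in [N], hence so are the bounds for the
    cutoffs and their derivatives. *)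
Lemma dilation_bound (j m : nat) :
  0 <= dilation j m <= (theta / b1) `^ Theta theta.
Proof.
have /andP[th0 th1] := theta01; have T1 := Theta_gt1 theta01.
have T0 : 0 < Theta theta by exact: lt_trans T1.
rewrite /dilation; case: ifPn => [/andP[lo _]|_]; last by rewrite lexx powR_ge0.
case: (posnP j) => [->|j0].
  rewrite mulr0 powR0 ?mul0r ?lexx ?powR_ge0//; exact: lt0r_neq0.
have jR : 0 < j%:R :> R by rewrite ltr0n.
have m0 : 0 < m%:R :> R by apply: lt_le_trans lo; rewrite mulr_gt0// divr_gt0.
have NmT : 0 < N * m%:R `^ Theta theta by rewrite mulr_gt0// powR_gt0.
apply/andP; split; first by rewrite divr_ge0 ?powR_ge0// ltW.
rewrite ler_pdivrMr//.
have -> : theta * j%:R = (theta / b1) * (b1 * j%:R) by field; rewrite lt0r_neq0.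
rewrite powRM ?divr_ge0 ?mulr_ge0 ?(ltW th0) ?(ltW b1_gt0)//.
rewrite ler_wpM2l ?powR_ge0//.
have bj0 : 0 <= b1 * j%:R by rewrite mulr_ge0 ?(ltW b1_gt0).
have : (b1 * j%:R / N `^ (1 - theta)) `^ Theta theta <= m%:R `^ Theta theta.
  apply: ge0_ler_powR; rewrite ?nnegrE ?(ltW T0) ?(ltW m0)//.
    by rewrite divr_ge0 ?(ltW scale_gt0).
  by rewrite -mulrA.
by rewrite powR_div// scale_powR_Theta ler_pdivrMr// [_ * N]mulrC.
Qed.

(** * Amplitudes and energy of one block *)

Variable Cf : R.
Hypothesis Cf_ge0 : 0 <= Cf.
Hypothesis fourier_le : forall x, 0 <= x ->
  Normc.normc (fourier f x) * (1 + x) ^+ 2 <= Cf.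

Definition amplitude_const : R :=
  2 * Normc.normc (c1 theta) ^+ 2 * Cf * (2 / b1) `^ Theta theta / b1.

(** With [J = 2^b] and [M = J / N^(1-theta)], the quotient [J^Theta / M^(Theta+1)] equals [N / M].
    The prefactor [N^-2] leaves [1 / (N * M)], and the last factor is the decay of the Fourier
    transform. *)
Definition amplitude_size (b : nat) : R :=
  amplitude_const / (N * ((2 ^ b)%:R / N `^ (1 - theta)) *
    (1 + (2 ^ b)%:R / N) ^+ 2).

Lemma amplitude_const_ge0 : 0 <= amplitude_const.
Proof.
apply: divr_ge0; last exact: ltW.
apply: mulr_ge0; last exact: powR_ge0.
by apply: mulr_ge0 => //; apply: mulr_ge0 => //; exact: sqr_ge0.
Qed.

Lemma amplitude_size_ge0 b : 0 <= amplitude_size b.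
Proof.
apply: divr_ge0; first exact: amplitude_const_ge0.
apply: mulr_ge0; last exact: sqr_ge0.
by apply: mulr_ge0; [exact: ltW|apply: divr_ge0 => //; exact: ltW].
Qed.

Lemma amplitude_le (b j m n : nat) : (2 ^ b <= j < 2 * 2 ^ b)%N ->
  Normc.normc (amplitude (j, (m, n))) <= (m != n)%:R * amplitude_size b.
Proof.
move=> /andP[bj jb]; have T1 := Theta_gt1 theta01.
rewrite /amplitude; case: ifPn => [/and4P[_ -> mr nr]|_]; last first.
  by rewrite Normc.normc0 mulr_ge0// amplitude_size_ge0.
rewrite mul1r /amplitude_size /amplitude_const.
have := normc_ge0 (c1 theta); move: (Normc.normc (c1 theta)) => q q0.
rewrite !Normc.normcM !normc_real.
have J0 : 0 < (2 ^ b)%:R :> R by rewrite ltr0n expn_gt0.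
have jJ : (2 ^ b)%:R <= j%:R :> R by rewrite ler_nat.
have j2J : j%:R <= 2 * (2 ^ b)%:R :> R by rewrite -natrM ler_nat ltnW.
have m1 := in_mrange_ge bj mr; have n1 := in_mrange_ge bj nr.
set J : R := (2 ^ b)%:R in J0 jJ j2J m1 n1 *.
set D := N `^ (1 - theta) in m1 n1 *.
have D0 : 0 < D := scale_gt0; have b10 := b1_gt0.
have M0 : 0 < J / D by rewrite divr_gt0.
have bM0 : 0 < b1 * (J / D) by rewrite mulr_gt0.
have c0 : 0 <= 2 * q ^+ 2 / N ^+ 2.
  by apply: divr_ge0; [apply: mulr_ge0 => //; exact: sqr_ge0|exact: sqr_ge0].
rewrite (ger0_norm c0).
rewrite (ger0_norm (_ : 0 <= _ / _)); last by rewrite divr_ge0 ?powR_ge0.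
have u0 : 0 < (1 + J / N) ^+ 2 by rewrite exprn_gt0// addr_gt0// divr_gt0.
have hf : Normc.normc (fourier f (j%:R / N)) <= Cf / (1 + J / N) ^+ 2.
  have x0 : 0 <= j%:R / N by rewrite divr_ge0// ltW.
  rewrite ler_pdivlMr//; apply: le_trans (fourier_le x0).
  rewrite ler_wpM2l ?normc_ge0// ler_sqr ?nnegrE ?addr_ge0// ?divr_ge0 ?(ltW J0) ?(ltW N_gt0)//.
  by rewrite lerD2l ler_pM2r ?invr_gt0.
have hp : j%:R `^ Theta theta / (m%:R * n%:R) `^ ((Theta theta + 1) / 2) <=
    (2 / b1) `^ Theta theta * N / (b1 * (J / D)).
  have sqT (x y : R) : 0 < x -> x `^ y = (x * x) `^ (y / 2).
    move=> x0; rewrite powRM ?(ltW x0)// -powRD ?(lt0r_neq0 x0) ?implybT//.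
    by congr (_ `^ _); field.
  have den : (b1 * (J / D)) `^ (Theta theta + 1) <=
      (m%:R * n%:R) `^ ((Theta theta + 1) / 2).
    rewrite (sqT _ _ bM0).
    have bM1 := ltW bM0.
    apply: ge0_ler_powR; rewrite ?nnegrE ?(mulr_ge0 bM1 bM1)//; first by lra.
    exact: ler_pM.
  have den0 : 0 < (b1 * (J / D)) `^ (Theta theta + 1) by rewrite powR_gt0.
  apply: (@le_trans _ _ ((2 * J) `^ Theta theta / (b1 * (J / D)) `^ (Theta theta + 1))).
    apply: ler_pM; rewrite ?powR_ge0 ?invr_ge0//.
      by apply: ge0_ler_powR; rewrite ?nnegrE ?mulr_ge0 ?(ltW J0)//; lra.
    by rewrite lef_pV2 ?posrE// (lt_le_trans den0).
  have tb0 : 0 <= 2 / b1 by rewrite divr_ge0// ltW.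
  have -> : (2 * J) `^ Theta theta =
      (2 / b1) `^ Theta theta * N * (b1 * (J / D)) `^ Theta theta.
    have -> : 2 * J = (2 / b1 * D) * (b1 * (J / D)).
      by field; rewrite !lt0r_neq0.
    rewrite (@powRM R (2 / b1 * D) (b1 * (J / D)) _ (mulr_ge0 tb0 (ltW D0)) (ltW bM0)).
    by rewrite (@powRM R (2 / b1) D _ tb0 (ltW D0)) scale_powR_Theta.
  rewrite powRD; last by rewrite (lt0r_neq0 bM0) implybT.
  rewrite powRr1 ?(ltW bM0)//.
  rewrite le_eqVlt; apply/orP; left; apply/eqP.
  have p0 := powR_gt0 (Theta theta) bM0.
  by field; rewrite !lt0r_neq0.
apply: (@le_trans _ _ (2 * q ^+ 2 / N ^+ 2 *
   (Cf / (1 + J / N) ^+ 2) * ((2 / b1) `^ Theta theta * N / (b1 * (J / D))))).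
  apply: ler_pM => //.
  - by apply: mulr_ge0 => //; exact: normc_ge0.
  by rewrite ler_wpM2l.
rewrite le_eqVlt; apply/orP; left; apply/eqP.
by field; rewrite !lt0r_neq0//= addr_gt0.
Qed.

Lemma block_energy (b : nat) :
  \sum_(t <- block b) \sum_(t' <- block b) Normc.normc (amplitude t) *
    Normc.normc (amplitude t') * osc_weight (frequency t - frequency t') <=
  amplitude_size b ^+ 2 * (1 + (c2 theta)^-1) *
  \sum_(j <- iota (2 ^ b) (2 ^ b)) \sum_(j' <- iota (2 ^ b) (2 ^ b))
  \sum_(m <- block_range b) \sum_(n <- block_range b)
  \sum_(m' <- block_range b) \sum_(n' <- block_range b)
    (m != n)%:R * osc_weight
      (j%:R `^ Theta theta * (phi (Theta theta) m - phi (Theta theta) n) -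
       j'%:R `^ Theta theta * (phi (Theta theta) m' - phi (Theta theta) n')).
Proof.
have q0 := amplitude_size_ge0 b; have c20 := c2_gt0 theta01.
have jE j : j \in iota (2 ^ b) (2 ^ b) -> (2 ^ b <= j < 2 * 2 ^ b)%N.
  by rewrite mem_iota addnn -mul2n.
rewrite big_allpairs mulr_sumr big_seq [leRHS]big_seq; apply: ler_sum => j /jE jb.
rewrite exchange_big big_allpairs mulr_sumr big_seq [leRHS]big_seq.
apply: ler_sum => j' /jE j'b.
rewrite exchange_big big_allpairs mulr_sumr; apply: ler_sum => m _.
rewrite mulr_sumr; apply: ler_sum => n _.
rewrite big_allpairs mulr_sumr; apply: ler_sum => m' _.
rewrite mulr_sumr; apply: ler_sum => n' _.
have hA := amplitude_le m n jb.
(* The condition [m != n] is retained for the first pair, where [phi_slope] divides by the distance;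
   the second amplitude gets the plain bound. *)
have hA' : Normc.normc (amplitude (j', (m', n'))) <= amplitude_size b.
  apply: le_trans (amplitude_le m' n' j'b) _.
  by case: (m' != n'); rewrite ?mul1r// mul0r.
have hAA := ler_pM (normc_ge0 _) (normc_ge0 _) hA hA'.
have hO : osc_weight (frequency (j, (m, n)) - frequency (j', (m', n'))) <=
   (1 + (c2 theta)^-1) * osc_weight
      (j%:R `^ Theta theta * (phi (Theta theta) m - phi (Theta theta) n) -
       j'%:R `^ Theta theta * (phi (Theta theta) m' - phi (Theta theta) n')).
  by rewrite /frequency -mulrBr; exact: osc_weight_scale.
have nn0 : 0 <= Normc.normc (amplitude (j, (m, n))) *
    Normc.normc (amplitude (j', (m', n'))) by rewrite mulr_ge0 ?normc_ge0.
apply: le_trans (ler_pM nn0 (osc_weight_ge0 _) hAA hO) _.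
by rewrite le_eqVlt; apply/orP; left; apply/eqP; ring.
Qed.

(** [k0] and [L] will satisfy [b2 <= 2^k0] and [Theta <= L]; they make the harmonic sum up to [P]
    and the number of layers linear in [B.+1]. The factors in [2 * b2] come from [P^3] and from
    comparing [V] with [N]. *)
Definition energy_const (k0 L : nat) : R :=
  amplitude_const ^+ 2 * (1 + (c2 theta)^-1) * (2 * L.+2%:R *
  (count_const (Theta theta) (b1 / (2 * b2)) * (2 * b2) ^+ 3 *
   (1 + (2 * b2) `^ Theta theta) * (1 + 2 * b2 * (2 * b2) `^ Theta theta) *
   k0.+1%:R)).

Lemma energy_const_ge0 k0 L : 0 <= energy_const k0 L.
Proof.
have b20 := ltW b2_gt0; have c20 := c2_gt0 theta01.
have tb : 0 <= 2 * b2 by rewrite mulr_ge0.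
have e0 : 0 <= (2 * b2) `^ Theta theta by exact: powR_ge0.
have cc0 := count_const_ge0 (b1 / (2 * b2)) (Theta_gt1 theta01).
apply: mulr_ge0.
  apply: mulr_ge0; first exact: sqr_ge0.
  by rewrite addr_ge0// invr_ge0 ltW.
apply: mulr_ge0 => //; apply: mulr_ge0 => //.
apply: mulr_ge0; last by rewrite addr_ge0// mulr_ge0.
by apply: mulr_ge0; [apply: mulr_ge0 => //; exact: exprn_ge0|exact: addr_ge0].
Qed.

(** With [u = J / N] the powers combine to [(N * J * nu)^-2 * (J * nu)^3 * J = nu * u^2], while the
    factors [1 + u] leave [(1 + u)^-2]. What remains is [nu * (u / (1 + u))^2 <= nu]. *)
Lemma energy_numeric (C0 w l cc J nu P x y E1 E2 Hs S b : R) :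
  0 < N -> 0 < J -> 0 < nu -> 0 <= w -> 0 <= l -> 0 <= cc ->
  0 <= P -> P <= b * (J * nu) -> 0 <= x -> 0 <= y -> 0 <= Hs -> 0 <= b ->
  1 + x <= E1 * (1 + J / N) -> 1 + y <= E2 * (1 + J / N) -> Hs <= S ->
  (C0 / (N * (J * nu) * (1 + J / N) ^+ 2)) ^+ 2 * w *
    (2 * l * (cc * P ^+ 3 * J * (1 + x) * (1 + y) * Hs)) <=
  C0 ^+ 2 * w * (2 * l * (cc * b ^+ 3 * E1 * E2 * S)) * nu.
Proof.
move=> N0 J0 nu0 w0 l0 cc0 P0 Pb x0 y0 Hs0 b0 hx hy hS.
set u := J / N in hx hy *.
have u0 : 0 < u by rewrite divr_gt0.
have M0 : 0 < J * nu by rewrite mulr_gt0.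
have x1 : 0 <= 1 + x by rewrite addr_ge0.
have y1 : 0 <= 1 + y by rewrite addr_ge0.
have P3 : 0 <= P ^+ 3 by rewrite exprn_ge0.
have P3b : P ^+ 3 <= (b * (J * nu)) ^+ 3.
  by rewrite lerXn2r ?nnegrE// mulr_ge0// ltW.
have h1 : cc * P ^+ 3 * J <= cc * (b * (J * nu)) ^+ 3 * J.
  by rewrite ler_wpM2r ?(ltW J0)// ler_wpM2l.
have c10 : 0 <= cc * P ^+ 3 * J by rewrite !mulr_ge0// ltW.
have h2 := ler_pM c10 x1 h1 hx; have c20 := mulr_ge0 c10 x1.
have h3 := ler_pM c20 y1 h2 hy; have c30 := mulr_ge0 c20 y1.
have h4 := ler_pM c30 Hs0 h3 hS.
set A := (C0 / _) ^+ 2 * w.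
have A0 : 0 <= A by apply: mulr_ge0 => //; exact: sqr_ge0.
have h5 : A * (2 * l * (cc * P ^+ 3 * J * (1 + x) * (1 + y) * Hs)) <=
  A * (2 * l * (cc * (b * (J * nu)) ^+ 3 * J * (E1 * (1 + u)) * (E2 * (1 + u)) * S)).
  by apply: ler_wpM2l => //; apply: ler_wpM2l => //; rewrite mulr_ge0.
apply: le_trans h5 _.
have u1 : 0 < 1 + u by rewrite addr_gt0.
have -> : A * (2 * l * (cc * (b * (J * nu)) ^+ 3 * J * (E1 * (1 + u)) * (E2 * (1 + u)) * S)) =
  C0 ^+ 2 * w * (2 * l * (cc * b ^+ 3 * E1 * E2 * S)) * nu * (u / (1 + u)) ^+ 2.
  by rewrite /A /u; field; rewrite !lt0r_neq0//= addr_gt0.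
have E10 : 0 <= E1.
  by rewrite -(ler_pM2r u1) mul0r; apply: le_trans hx.
have E20 : 0 <= E2.
  by rewrite -(ler_pM2r u1) mul0r; apply: le_trans hy.
have S0 : 0 <= S by apply: le_trans hS.
rewrite ler_piMr//.
  apply: mulr_ge0; last exact: ltW.
  apply: mulr_ge0; first by apply: mulr_ge0 => //; exact: sqr_ge0.
  apply: mulr_ge0; first by rewrite mulr_ge0.
  by do 4 apply: mulr_ge0 => //; exact: exprn_ge0.
apply: exprn_ile1; first by apply: divr_ge0; exact: ltW.
by rewrite ler_pdivrMr// mul1r lerDr.
Qed.

(** In the cube of [B.+1], one factor counts the layers of the oscillatory weight and each of the
    two harmonic sums gives another. *)
Lemma block_energy_le (b B k0 L : nat) : (b < B)%N -> b2 <= (2 ^ k0)%:R ->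
  Theta theta <= L%:R ->
  \sum_(t <- block b) \sum_(t' <- block b) Normc.normc (amplitude t) *
    Normc.normc (amplitude t') * osc_weight (frequency t - frequency t') <=
  energy_const k0 L * N `^ (theta - 1) * B.+1%:R ^+ 3.
Proof.
move=> bB b2k TL; have T1 := Theta_gt1 theta01; have b20 := b2_gt0; have b10 := b1_gt0.
(* An empty range of [m] is treated apart, since the counting lemmas ask for [P > 0]. *)
have [P0|] := posnP (block_bound b).
  have -> : block b = [::].
    by rewrite /block /block_range P0 /=; elim: (iota _ _).
  rewrite big_nil; apply: mulr_ge0; last exact: exprn_ge0.
  by apply: mulr_ge0; [exact: energy_const_ge0|exact: powR_ge0].
set P := block_bound b => P0.
apply: le_trans (block_energy b) _.
have J0 : (0 < 2 ^ b)%N by rewrite expn_gt0.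
have k1 : 0 < b1 / (2 * b2) by rewrite divr_gt0// mulr_gt0.
have uI : uniq (block_range b) by rewrite filter_uniq ?iota_uniq.
have rI m : m \in block_range b ->
    [/\ (0 < m)%N, (m <= P)%N & b1 / (2 * b2) * P%:R <= m%:R].
  by rewrite mem_filter mem_iota add1n ltnS => /and3P[].
have JB : (2 * 2 ^ b <= 2 ^ B)%N by rewrite -expnS leq_pexp2l.
(* As [2 * 2^b <= 2^B] and [Theta <= L], the layers up to [2^(1 + B * L)] cover all frequency
   differences of the block. *)
have hL : 2 * (2 * 2 ^ b)%:R `^ Theta theta <= 2 ^+ (1 + B * L) :> R.
  rewrite exprD expr1 ler_wpM2l//.
  apply: (@le_trans _ _ ((2 ^ B)%:R `^ Theta theta)).
    by apply: ge0_ler_powR; rewrite ?nnegrE ?ler_nat//; lra.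
  apply: (@le_trans _ _ ((2 ^ B)%:R `^ L%:R)).
    by rewrite ler_powR// ler1n expn_gt0.
  by rewrite powR_mulrn// natrX exprM.
have osc := osc_sum_le T1 k1 P0 J0 uI rI hL.
have w0 : 0 <= 1 + (c2 theta)^-1 by rewrite addr_ge0// invr_ge0 ltW// (c2_gt0 theta01).
have q20 : 0 <= amplitude_size b ^+ 2 * (1 + (c2 theta)^-1).
  by apply: mulr_ge0 => //; exact: sqr_ge0.
apply: le_trans (ler_wpM2l q20 osc) _.
have cc0 := count_const_ge0 (b1 / (2 * b2)) T1.
rewrite /amplitude_size; set J : R := (2 ^ b)%:R.
have JR0 : 0 < J by rewrite ltr0n.
pose nu : R := N `^ (theta - 1).
have nu0 : 0 < nu by rewrite powR_gt0.
have ME : J / N `^ (1 - theta) = J * nu.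
  rewrite /nu (_ : theta - 1 = - (1 - theta)); last by ring.
  by rewrite powRN.
have nu1 : nu <= 1.
  have /andP[th0 th1] := theta01.
  by rewrite /nu -[leRHS](powRr0 N) ler_powR//; lra.
have Pb : P%:R <= 2 * b2 * (J * nu).
  rewrite /P /block_bound -/J ME truncn_le.
  by rewrite !mulr_ge0// ltW.
have PR0 : 0 < P%:R :> R by rewrite ltr0n.
have N0 := N_gt0.
pose e0 : R := (2 * b2) `^ Theta theta.
have e00 : 0 < e0 by rewrite powR_gt0// mulr_gt0.
have V0 : 0 < (J / P%:R) `^ Theta theta by rewrite powR_gt0// divr_gt0.
(* [P <= 2 * b2 * J / N^(1-theta)] gives [J / P >= N^(1-theta) / (2 * b2)]; raised to the power
   [Theta], the numerator becomes [N] and the denominator [e0]. *)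
have hV : N <= e0 * (J / P%:R) `^ Theta theta.
  rewrite /e0 -powRM ?mulr_ge0 ?divr_ge0 ?(ltW b20) ?(ltW JR0) ?(ltW PR0)//.
  rewrite -{1}scale_powR_Theta; apply: ge0_ler_powR.
  - lra.
  - by rewrite nnegrE ltW// scale_gt0.
  - by rewrite nnegrE !mulr_ge0 ?invr_ge0// ltW.
  rewrite mulrA ler_pdivlMr//.
  apply: le_trans (ler_wpM2l (ltW scale_gt0) Pb) _.
  rewrite -ME le_eqVlt; apply/orP; left; apply/eqP; field.
  by rewrite lt0r_neq0.
have Vinv (z : R) : 0 <= z -> z / (J / P%:R) `^ Theta theta <= e0 * (z / N).
  move=> z0; rewrite ler_pdivrMr//.
  have -> : e0 * (z / N) * (J / P%:R) `^ Theta theta =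
    z * (e0 * (J / P%:R) `^ Theta theta) / N by ring.
  by rewrite ler_pdivlMr// ler_wpM2l.
have u0 : 0 < J / N by rewrite divr_gt0.
have hx : 1 + J / (J / P%:R) `^ Theta theta <= (1 + e0) * (1 + J / N).
  have := Vinv _ (ltW JR0); have : 0 <= e0 * (J / N) by rewrite mulr_ge0// ltW.
  by lra.
have hy : 1 + P%:R / (J / P%:R) `^ Theta theta <= (1 + 2 * b2 * e0) * (1 + J / N).
  have PJ : P%:R <= 2 * b2 * J.
    apply: le_trans Pb _; rewrite ler_wpM2l ?mulr_ge0 ?(ltW b20)//.
    by rewrite ler_piMr// ltW.
  have h1 := Vinv _ (ltW PR0).
  have h2 : e0 * (P%:R / N) <= e0 * (2 * b2 * J / N).
    by rewrite ler_wpM2l ?(ltW e00)// ler_wpM2r ?invr_ge0 ?(ltW N0).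
  have h3 : 0 <= b2 * e0 by rewrite mulr_ge0// ltW.
  have h4 : 0 <= b2 * e0 * (J / N) by apply: mulr_ge0 => //; exact: ltW.
  by lra.
have HJ : harmonic_sum R (2 * 2 ^ b) <= B.+1%:R.
  rewrite -expnS; apply: le_trans (harmonic_sum_pow2 R b.+1) _.
  by rewrite ler_nat.
have HP : harmonic_sum R P <= k0.+1%:R * B.+1%:R.
  have PB : (P <= 2 ^ (B + k0))%N.
    rewrite -(ler_nat R); apply: le_trans Pb _.
    apply: (@le_trans _ _ (b2 * (2 * J))).
      rewrite [2 * b2]mulrC -mulrA ler_wpM2l ?(ltW b20)// ler_wpM2l//.
      by rewrite ler_piMr// ltW.
    rewrite expnD mulnC natrM; apply: ler_pM; rewrite ?(ltW b20)//.
      by rewrite mulr_ge0// ltW.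
    by rewrite /J -natrM ler_nat.
  apply: le_trans (le_harmonic_sum R PB) _.
  apply: le_trans (harmonic_sum_pow2 R _) _.
  by rewrite -natrM ler_nat leq_addn_mulS.
have HH0 : 0 <= harmonic_sum R P * harmonic_sum R (2 * 2 ^ b).
  by rewrite mulr_ge0 ?harmonic_sum_ge0.
have HS : harmonic_sum R P * harmonic_sum R (2 * 2 ^ b) <=
    k0.+1%:R * B.+1%:R ^+ 2.
  by rewrite expr2 mulrA ler_pM ?harmonic_sum_ge0.
have x0 : 0 <= J / (J / P%:R) `^ Theta theta by rewrite divr_ge0 ?(ltW JR0) ?(ltW V0).
have y0 : 0 <= P%:R / (J / P%:R) `^ Theta theta by rewrite divr_ge0 ?(ltW V0).
have tb0 : 0 <= 2 * b2 by rewrite mulr_ge0// ltW.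
have := energy_numeric amplitude_const N0 JR0 nu0 w0 (ler0n R (1 + B * L).+1) cc0
  (ltW PR0) Pb x0 y0 HH0 tb0 hx hy HS.
rewrite ME => h1; apply: le_trans h1 _.
have lL : (1 + B * L).+1%:R <= L.+2%:R * B.+1%:R :> R.
  by rewrite -natrM ler_nat leq_mulS_mulS.
rewrite /energy_const -/nu -/e0.
set X := count_const _ _ * _ * _ * _.
have X0 : 0 <= X.
  apply: mulr_ge0; last by rewrite addr_ge0// mulr_ge0// ltW.
  by apply: mulr_ge0; [apply: mulr_ge0 => //; exact: exprn_ge0|rewrite addr_ge0// ltW].
have Y0 : 0 <= amplitude_const ^+ 2 * (1 + (c2 theta)^-1) * 2 * X * k0.+1%:R *
    B.+1%:R ^+ 2 * nu.
  have ac0 : 0 <= amplitude_const ^+ 2 by exact: sqr_ge0.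
  have B20 : 0 <= B.+1%:R ^+ 2 :> R by exact: exprn_ge0.
  apply: mulr_ge0; last exact: ltW.
  by do 4 apply: mulr_ge0 => //; exact: mulr_ge0.
have := ler_wpM2l Y0 lL.
by congr (is_true (_ <= _)); ring.
Qed.

End blocks.

(** * The theorem *)

Lemma continuous_normc_trig_sum (R : realType) (I : Type) (s : seq I)
    (c : I -> R[i]) (w : I -> R -> R) (lam : I -> R) :
  (forall i, continuous (w i)) ->
  continuous (fun x : R =>
    Normc.normc (\sum_(i <- s) c i * (w i x)%:C * e (lam i * x)) ^+ 2 : R).
Proof.
move=> cw; under eq_fun => x do rewrite (normc_trig_sum_sqr s c (fun i => w i x)).
have cC (t : R) : continuous (fun _ : R => t) by move=> x; exact: cvg_cst.
apply: continuous_sumR => i; apply: continuous_sumR => k.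
apply: continuous_addR; apply: continuous_mulR => //;
  (apply: continuous_mulR; first exact: continuous_mulR).
- exact: (C1_continuous (C1_cos (2 * pi * (lam i - lam k)))).
- exact: (C1_continuous (C1_sin (2 * pi * (lam i - lam k)))).
Qed.

Lemma dyadic_cover (R : realType) (X : R) : 0 <= X ->
  exists2 B : nat, X < (2 ^ B)%:R & (2 ^ B)%:R <= 2 * (X + 1).
Proof.
move=> X0; exists (trunc_log 2 (Num.trunc X)).+1.
  apply: lt_le_trans (truncnS_gt X) _; rewrite ler_nat.
  by rewrite trunc_log_ltn.
have [t0|t0] := posnP (Num.trunc X).
  by rewrite t0 trunc_log0 expn1; lra.
have := trunc_logP (isT : (1 < 2)%N) t0; rewrite -(ler_nat R) => h.
have := truncn_le X; rewrite X0 => ht.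
by rewrite expnS natrM; have : (2 ^ trunc_log 2 (Num.trunc X))%:R <= X; [exact: le_trans ht|lra].
Qed.

(* The number of dyadic blocks is logarithmic in N. *)
Lemma dyadic_blocks (R : realType) (eps a eta : R) :
  0 < eps -> 0 < a -> 0 < eta ->
  exists2 C : R, 0 <= C & forall N : R, 1 <= N ->
    exists2 B : nat, a * N `^ (1 + eps) < (2 ^ B)%:R & B.+1%:R <= C * N `^ eta.
Proof.
move=> e0 a0 eta0; have e10 : 0 < 1 + eps by lra.
have q0 : 0 < eta / (1 + eps) by exact: divr_gt0.
have [C C0 hC] := succ_le_powR2 q0.
exists (C * (2 * (a + 1)) `^ (eta / (1 + eps))) => [|N N1].
  by rewrite mulr_ge0 ?powR_ge0// ltW.
have NE1 : 1 <= N `^ (1 + eps).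
  by rewrite -[leLHS](powRr0 N); apply: ler_powR => //; exact: ltW.
have X0 : 0 <= a * N `^ (1 + eps) by rewrite mulr_ge0 ?powR_ge0// ltW.
have [B aB hB] := dyadic_cover X0; exists B => //.
apply: le_trans (hC B) _; rewrite -mulrA ler_wpM2l ?(ltW C0)//.
have -> : N `^ eta = (N `^ (1 + eps)) `^ (eta / (1 + eps)).
  by rewrite -powRrM; congr (_ `^ _); field; exact: lt0r_neq0.
rewrite -powRM ?powR_ge0//; last by lra.
have p0 : 0 <= 2 ^+ B :> R by exact: exprn_ge0.
have hX : 2 ^+ B <= 2 * (a + 1) * N `^ (1 + eps).
  by rewrite -natrX; apply: le_trans hB _; lra.
apply: ge0_ler_powR => //; first exact: ltW.
by rewrite nnegrE; exact: le_trans p0 hX.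
Qed.

(** [x] will be [B.+1]: cubed in [block_energy_le], and twice more from Cauchy-Schwarz and summation
    over the blocks. The exponents add up to [theta - 1 + 5 * (1 - theta - delta) / 5 = - delta]. *)
Lemma powR_saving (R : realType) (theta delta C N x : R) : 0 < N -> 0 <= x ->
  x <= C * N `^ ((1 - theta - delta) / 5) ->
  N `^ (theta - 1) * x ^+ 5 <= C ^+ 5 * N `^ (- delta).
Proof.
move=> N0 x0 xC; have Nt0 : 0 <= N `^ (theta - 1) by exact: powR_ge0.
have x5 : x ^+ 5 <= (C * N `^ ((1 - theta - delta) / 5)) ^+ 5.
  by rewrite lerXn2r ?nnegrE// (le_trans _ xC).
apply: le_trans (ler_wpM2l Nt0 x5) _.
rewrite exprMn -(powR_mulrn 5 (powR_ge0 N _)) -powRrM mulrCA.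
rewrite -powRD; last by rewrite (lt0r_neq0 N0) implybT.
by rewrite (_ : _ + _ = - delta)//; field.
Qed.

Theorem theorem2p5 (R : realType) (theta eps a1 a2 b1 b2 : R)
    (f : R -> R[i]) (h rho : R -> R)
    (theta01 : 0 < theta < 1)
    (f_smooth : csmooth f)
    (f_csupp : compact (tsupp f))
    (f_even : forall x : R, f (- x) = f x)
    (h_smooth : smooth h)
    (h_ge0 : forall x : R, 0 <= h x)
    (h_supp : tsupp h `<=` `[1, 2])
    (eps_gt0 : 0 < eps)
    (rho_smooth : smooth rho)
    (rho_ge0 : forall x : R, 0 <= rho x)
    (rho_supp : tsupp rho `<=` `[1, 2])
    (rho_int : (\int[lebesgue_measure]_(x in `]0%R, +oo[) (rho x / x)%:E = 1)%E)
    (a1_gt0 : 0 < a1) (a2_gt0 : 0 < a2) (b1_gt0 : 0 < b1) (b2_gt0 : 0 < b2) :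
  forall delta : R, 0 < delta < 1 - theta ->
  exists C : R, forall N : R, 1 <= N ->
    (int_mu theta rho
       (fun alpha =>
          (Normc.normc (Roff theta eps a1 a2 b1 b2 f h N alpha) ^+ 2)%R)
     <= (C * N `^ (- delta))%:E)%E.
Proof.
move=> delta /andP[d0 d1].
have /andP[th0 th1] := theta01.
have T1 : 1 < Theta theta by exact: Theta_gt1.
have T0 : 0 < Theta theta by exact: lt_trans T1.
have rho0 x : ~~ (1 <= x <= 2) -> rho x = 0.
  move=> nx; apply/eqP; apply: contraT => rx.
  have /rho_supp : tsupp rho x by apply: subset_closure.
  by rewrite /= in_itv/= (negPf nx).
(* Squaring the prefactor of [Roff_blocks] gives [beta^2]; the Jacobian of the substitution takes up
   one factor [beta], and [beta * rho beta] is left as the weight. *)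
pose r := fun x : R => x * rho x.
have hr := C1M (@C1_id R) (smooth_C1 0 rho_smooth).
rewrite -/(derive1n 0 rho) -[derive1n 0 rho]/rho in hr.
set dr := (fun x : R => 1 * rho x + x * _) in hr.
have ab : (1 / 2 : R) < 3 by lra.
have [Br Br0 hBr] := continuous_bounded_itv (ltW ab) (C1_continuous hr).
have [Bdr Bdr0 hBdr] := continuous_bounded_itv (ltW ab) hr.2.
have r_a : r (1 / 2) = 0.
  by rewrite /r rho0 ?mulr0//; apply/negP => /andP[]; lra.
have r_b : r 3 = 0.
  by rewrite /r rho0 ?mulr0//; apply/negP => /andP[]; lra.
have [Cf Cf0 hCf] := fourier_decay f_smooth f_csupp.
pose K := (theta / b1) `^ Theta theta.
have K0 : 0 <= K by exact: powR_ge0.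
have hh := smooth_C1 0 h_smooth.
(* The arguments of [h] are dilations, at most [K], times [x <= 3]. They stay in [[0, 3 * K]], where
   [h] and its derivative are bounded independently of [N]. *)
have K30 : 0 <= 3 * K by rewrite mulr_ge0.
have [Bh Bh0 hBh] := continuous_bounded_itv K30 (C1_continuous hh).
have [Bdh Bdh0 hBdh] := continuous_bounded_itv K30 hh.2.
rewrite -[derive1n 0 h]/h in hBh hh.
set dh := derive1n 1 h in hh hBdh.
(* A common bound for the cutoffs, the weight and their derivatives; [2 * (K * Bdh * Bh)] comes from
   the product rule, each dilation contributing a factor at most [K]. *)
pose B0 := Bh * Bh + 2 * (K * Bdh * Bh) + Br + Bdr.
have hh0 : 0 <= Bh * Bh by rewrite mulr_ge0.
have kh0 : 0 <= K * Bdh * Bh by rewrite !mulr_ge0.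
have B00 : 0 <= B0 by rewrite /B0; lra.
have [k0 hk0] : exists k0 : nat, b2 <= (2 ^ k0)%:R.
  exists (Num.trunc b2).+1; apply: le_trans (ltW (truncnS_gt b2)) _.
  by rewrite ler_nat ltnW// ltn_expl.
have [L hL] : exists L : nat, Theta theta <= L%:R.
  by exists (Num.trunc (Theta theta)).+1; exact: ltW (truncnS_gt _).
have eta0 : 0 < (1 - theta - delta) / 5 by rewrite divr_gt0//; lra.
have [C2 C20 hC2] := dyadic_blocks eps_gt0 a2_gt0 eta0.
pose E := energy_const theta b1 b2 Cf k0 L.
pose C1 := 6 * B0 ^+ 3 * (3 - 1 / 2) * E.
exists (C1 * C2 ^+ 5) => N N1.
have N0 : 0 < N by lra.
have E0 : 0 <= E by apply: (@energy_const_ge0 R theta b1 b2).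
have C10 : 0 <= C1.
  rewrite /C1; apply: mulr_ge0 => //; apply: mulr_ge0; last lra.
  by apply: mulr_ge0 => //; exact: exprn_ge0.
have [B aB BC] := hC2 N N1.
pose amp := amplitude theta eps a1 a2 b1 b2 f N.
pose cut := cutoff theta b1 b2 N h.
pose frq := @frequency R theta.
pose dcut (t : nat * (nat * nat)) (x : R) : R := let: (j, (m, n)) := t in
  dilation theta b1 b2 N j m * dh (dilation theta b1 b2 N j m * x) *
    h (dilation theta b1 b2 N j n * x) +
  h (dilation theta b1 b2 N j m * x) *
   (dilation theta b1 b2 N j n * dh (dilation theta b1 b2 N j n * x)).
have hcut t : has_C1_derivative (cut t) (dcut t).
  case: t => [j [m n]].
  exact: C1M (C1_scale_arg _ hh) (C1_scale_arg _ hh).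
have dil j m : 0 <= dilation theta b1 b2 N j m <= K.
  exact: (@dilation_bound R theta).
have dilx j m x : x \in `[(1 / 2 : R), 3] ->
    dilation theta b1 b2 N j m * x \in `[0, 3 * K].
  rewrite !in_itv/= => /andP[x1 x3]; have /andP[q0 qK] := dil j m.
  rewrite mulr_ge0//=; last lra.
  by rewrite mulrC ler_pM//; lra.
have cutB t x : x \in `[(1 / 2 : R), 3] -> `|cut t x| <= B0 /\ `|dcut t x| <= B0.
  case: t => [j [m n]] xab; rewrite /cut /cutoff /dcut.
  have /andP[p0 pK] := dil j m; have /andP[q0 qK] := dil j n.
  have h1 := hBh _ (dilx j m x xab); have h2 := hBh _ (dilx j n x xab).
  have h3 := hBdh _ (dilx j m x xab); have h4 := hBdh _ (dilx j n x xab).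
  move: (dilation _ _ _ _ j m) (dilation _ _ _ _ j n) p0 pK q0 qK h1 h2 h3 h4.
  move=> p q p0 pK q0 qK h1 h2 h3 h4; split.
    rewrite normrM; apply: le_trans (ler_pM _ _ h1 h2) _ => //.
    by rewrite /B0; lra.
  apply: le_trans (ler_normD _ _) _; rewrite !normrM (ger0_norm p0) (ger0_norm q0).
  have e1 : p * `|dh (p * x)| * `|h (q * x)| <= K * Bdh * Bh.
    by apply: ler_pM => //; [exact: mulr_ge0|exact: ler_pM].
  have e2 : `|h (p * x)| * (q * `|dh (q * x)|) <= Bh * (K * Bdh).
    by apply: ler_pM => //; [exact: mulr_ge0|exact: ler_pM].
  by rewrite /B0; lra.
have rB x : x \in `[(1 / 2 : R), 3] -> `|r x| <= B0 /\ `|dr x| <= B0.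
  move=> xab; have := hBr x xab; have := hBdr x xab => h1 h2.
  by split; rewrite /B0; [apply: le_trans h2 _|apply: le_trans h1 _]; lra.
pose S b x := \sum_(t <- block theta b1 b2 N b) amp t * (cut t x)%:C * e (frq t * x).
pose G x := Normc.normc (\sum_(b <- iota 0 B) S b x) ^+ 2 * r x.
have ccut t : continuous (cut t) by exact: C1_continuous (hcut t).
have cr : continuous r by exact: C1_continuous hr.
have cSb b : continuous (fun x => Normc.normc (S b x) ^+ 2 * r x).
  apply: continuous_mulR => //.
  exact: (@continuous_normc_trig_sum R _ (block theta b1 b2 N b) amp cut frq ccut).
have cG : continuous G.
  apply: continuous_mulR => //.
  (* All blocks are concatenated into one list, so that the continuity of a single trigonometric sum
     applies. *)
  have flat x : \sum_(b <- iota 0 B) S b x =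
      \sum_(t <- flatten [seq block theta b1 b2 N b | b <- iota 0 B])
        amp t * (cut t x)%:C * e (frq t * x) by rewrite big_flatten big_map.
  under eq_fun do rewrite flat.
  exact: (@continuous_normc_trig_sum R _ _ amp cut frq ccut).
rewrite (@int_mu_substitution R theta rho _ G theta01 rho0 cG); last first.
  move=> alpha al0.
  rewrite (Roff_blocks f theta01 N1 a1_gt0 b1_gt0 b2_gt0 h al0 aB).
  rewrite Normc.normcM normc_real (ger0_norm (powR_ge0 _ _)) /G /r.
  rewrite -/(S _ _) -(mulr_powRB1 (ltW al0) T0).
  set Z := Normc.normc _; field.
  exact: lt0r_neq0.
rewrite lee_fin.
have block_int b : b \in iota 0 B ->
    rint (1 / 2) 3 (fun x => Normc.normc (S b x) ^+ 2 * r x) <=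
    C1 * N `^ (theta - 1) * B.+1%:R ^+ 3.
  rewrite mem_iota add0n => /andP[_ bB].
  apply: le_trans (@rint_normc_trig_sum R _ (block theta b1 b2 N b) amp cut dcut
    frq r dr _ _ B0 ab hcut hr r_a r_b cutB rB) _.
  have en := block_energy_le eps a1 a2 theta01 N1 b1_gt0 b2_gt0 Cf0 hCf bB hk0 hL.
  have c0 : 0 <= 6 * B0 ^+ 3 * (3 - 1 / 2).
    by apply: mulr_ge0; [apply: mulr_ge0 => //; exact: exprn_ge0|lra].
  have -> : C1 * N `^ (theta - 1) * B.+1%:R ^+ 3 =
    6 * B0 ^+ 3 * (3 - 1 / 2) * (E * N `^ (theta - 1) * B.+1%:R ^+ 3).
    by rewrite /C1; ring.
  by apply: ler_wpM2l; [exact: c0|exact: en].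
have csum : continuous (fun x : R => \sum_(b <- iota 0 B) (Normc.normc (S b x) ^+ 2 * r x)).
  exact: continuous_sumR.
(* Cauchy-Schwarz over the [B] blocks costs a factor [B] but spares all interactions between [j] of
   different dyadic sizes. It is applied pointwise, with the weight [r >= 0] on the interval. *)
have step1 : rint (1 / 2) 3 G <=
    rint (1 / 2) 3 (fun x => B%:R * \sum_(b <- iota 0 B) (Normc.normc (S b x) ^+ 2 * r x)).
  apply: le_Rintegral => //.
  - exact: continuous_integrable_itv.
  - apply: continuous_integrable_itv; apply: continuous_mulR => //.
    by move=> x; exact: cvg_cst.
  - move=> x; rewrite /= in_itv/= => /andP[x1 _].
    have r0 : 0 <= r x by rewrite /r mulr_ge0//; lra.
    rewrite /G -mulr_suml [leRHS]mulrA; apply: ler_wpM2r => //.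
    by have := normc_sum_sqr (iota 0 B) (fun b => S b x); rewrite size_iota.
apply: le_trans step1 _.
rewrite rintZ// rint_sum//.
have step2 := sum_le_size block_int; rewrite size_iota in step2.
apply: le_trans (ler_wpM2l (ler0n R B) step2) _.
have Nt0 : 0 <= N `^ (theta - 1) by exact: powR_ge0.
apply: (@le_trans _ _ (C1 * N `^ (theta - 1) * B.+1%:R ^+ 5)).
  have BB : B%:R <= B.+1%:R :> R by rewrite ler_nat.
  have c0 : 0 <= C1 * N `^ (theta - 1) * B.+1%:R ^+ 3.
    by apply: mulr_ge0; [exact: mulr_ge0|exact: exprn_ge0].
  rewrite [leLHS]mulrA [leRHS](_ : _ =
    B.+1%:R * B.+1%:R * (C1 * N `^ (theta - 1) * B.+1%:R ^+ 3)); last by ring.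
  by apply: ler_wpM2r => //; apply: ler_pM.
rewrite -[leLHS]mulrA -[leRHS]mulrA; apply: ler_wpM2l => //.
exact: (powR_saving N0 (ler0n R _) BC).
Qed.
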